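(* Let $K$ be a field, $S=K[x_1,\dots,x_n]$, and let $I\subset S$ be a polymatroidal ideal in at most three variables (i.e. at most three variables occur in the minimal monomial generators of $I$). Then $\mathrm{reg}\,I^{(k)}=\mathrm{reg}\,I^k$ and $I^{(k)}$ has linear quotients, for all $k\ge1$.
   Context: $S$ is standard graded; $\mathrm{reg}$ is Castelnuovo–Mumford regularity. The $k$th symbolic power is $I^{(k)}=\bigcap_{P\in\mathrm{Ass}(I)}(I^kS_P\cap S)$, with $\mathrm{Ass}(I)=\mathrm{Ass}(S/I)$. Let $\mathcal{G}(I)$ be the minimal monomial generating set of a monomial ideal $I$ and $\deg_{x_i}(u)$ the exponent of $x_i$ in a monomial $u$. A nonzero monomial ideal $I$ is *polymatroidal* if it is generated in a single degree and for all $u,v\in\mathcal{G}(I)$ and every $i$ with $\deg_{x_i}(u)>\deg_{x_i}(v)$ there is $j$ with $\deg_{x_j}(u)<\deg_{x_j}(v)$ and $x_j(u/x_i)\in\mathcal{G}(I)$. A monomial ideal $L$ has linear quotients if its minimal monomial generators can be ordered $u_1,\dots,u_s$ so that $(u_1,\dots,u_{i-1}):(u_i)$ is generated by variables for $i=2,\dots,s$. *)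

(* Defs.v *)
From HB Require Import structures.
From mathcomp Require Import all_boot all_order all_algebra.
From mathcomp Require Import mpoly.

Set Implicit Arguments.
Unset Strict Implicit.
Unset Printing Implicit Defensive.

Import GRing.Theory.
Local Open Scope ring_scope.

(* Ideals are Prop-valued predicates on a commutative ring; two ideals are
   identified when they have the same elements. *)

Definition same_ideal (R : comNzRingType) (I J : R -> Prop) : Prop :=
  forall f, I f <-> J f.

Definition is_ideal (R : comNzRingType) (I : R -> Prop) : Prop :=
  [/\ I 0, forall f g, I f -> I g -> I (f + g)
    & forall f g, I g -> I (f * g)].

Definition ideal_gen (R : comNzRingType) (A : R -> Prop) : R -> Prop :=
  fun f => exists2 s : seq (R * R),
    forall p, p \in s -> A p.2 & f = \sum_(p <- s) p.1 * p.2.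

Definition ideal_mul (R : comNzRingType) (I J : R -> Prop) : R -> Prop :=
  ideal_gen (fun f => exists g h, [/\ I g, J h & f = g * h]).

Definition ideal_pow (R : comNzRingType) (I : R -> Prop) (k : nat) :
  R -> Prop := iter k (ideal_mul I) (fun=> True).

Definition ideal_colon (R : comNzRingType) (I J : R -> Prop) : R -> Prop :=
  fun f => forall g, J g -> I (f * g).

Definition prime_ideal (R : comNzRingType) (P : R -> Prop) : Prop :=
  [/\ is_ideal P, ~ P 1 & forall f g, P (f * g) -> P f \/ P g].

(* P is in Ass(R/I): a prime that is the annihilator of a class f + I. *)
Definition associated_prime (R : comNzRingType) (I P : R -> Prop) : Prop :=
  prime_ideal P /\ exists f, forall g, P g <-> I (g * f).

(* The extension of I to the localization R_P, seen inside Frac(R). *)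
Definition ideal_loc (R : idomainType) (I P : R -> Prop) :
  {fraction R} -> Prop :=
  fun x => exists a b, [/\ I a, ~ P b & x = tofrac a / tofrac b].

Definition symbolic_pow (R : idomainType) (I : R -> Prop) (k : nat) :
  R -> Prop :=
  fun f => forall P, associated_prime I P -> ideal_loc (ideal_pow I k) P (tofrac f).

Definition monomial_gen (K : fieldType) (n : nat) (G : seq 'X_{1..n}) :
  {mpoly K[n]} -> Prop :=
  ideal_gen (fun f => exists2 m, m \in G & f = 'X_[m]).

Definition variable_gen (K : fieldType) (n : nat) (V : {set 'I_n}) :
  {mpoly K[n]} -> Prop :=
  ideal_gen (fun f => exists2 i, i \in V & f = 'X_i).

(* G lists, without repetition, a set of monomials generating I that is minimal
   for inclusion; such a set is unique, so G is unique up to order. *)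
Definition min_monomial_gens (K : fieldType) (n : nat)
    (I : {mpoly K[n]} -> Prop) (G : seq 'X_{1..n}) : Prop :=
  [/\ uniq G, same_ideal I (monomial_gen G)
    & forall G' : seq 'X_{1..n}, {subset G' <= G} ->
        same_ideal I (monomial_gen G') -> {subset G <= G'}].

Definition occurring_vars (n : nat) (G : seq 'X_{1..n}) : {set 'I_n} :=
  [set i | has (fun m : 'X_{1..n} => m i != 0%N) G].

Definition polymatroidal (K : fieldType) (n : nat)
    (I : {mpoly K[n]} -> Prop) : Prop :=
  exists G : seq 'X_{1..n},
    [/\ min_monomial_gens I G, G <> [::],
        exists d, forall u, u \in G -> mdeg u = d
      & forall u v, u \in G -> v \in G -> forall i, (v i < u i)%N ->
          exists2 j, (u j < v j)%N & (U_(j) + (u - U_(i)))%MM \in G].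

Definition has_linear_quotients (K : fieldType) (n : nat)
    (L : {mpoly K[n]} -> Prop) : Prop :=
  exists2 us : seq 'X_{1..n}, min_monomial_gens L us &
    forall i, (0 < i < size us)%N ->
      exists V : {set 'I_n},
        same_ideal
          (ideal_colon (@monomial_gen K n (take i us))
                       (monomial_gen [:: nth 0%MM us i]))
          (variable_gen V).

(* Sequences F_i = \bigoplus_a S(- gshift i a), with maps F_(i+1) -> F_i and
   F_0 -> S given by matrices acting on row vectors from the right.  Natural
   number shifts suffice for the free resolutions of ideals of S. *)
Record free_complex (K : fieldType) (n : nat) := FreeComplex {
  grank : nat -> nat;
  gshift : forall i, 'I_(grank i) -> nat;
  gaug : 'cV[{mpoly K[n]}]_(grank 0);
  gdiff : forall i, 'M[{mpoly K[n]}]_(grank i.+1, grank i) }.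

(* All maps are homogeneous of degree 0. *)
Definition graded_complex (K : fieldType) (n : nat) (F : free_complex K n) :
  Prop :=
  (forall a m, m \in msupp (gaug F a 0) -> mdeg m = gshift a) /\
  (forall i a b m, m \in msupp (gdiff F i a b) ->
     (mdeg m + gshift b)%N = gshift a).

(* ... -> F_1 -> F_0 -> I -> 0 is exact. *)
Definition resolves (K : fieldType) (n : nat) (F : free_complex K n)
    (I : {mpoly K[n]} -> Prop) : Prop :=
  [/\ forall f, I f <->
        exists v : 'rV_(grank F 0), f = (v *m gaug F) 0 0,
      forall v : 'rV_(grank F 0),
        v *m gaug F = 0 <-> exists w, v = w *m gdiff F 0
    & forall i (v : 'rV_(grank F i.+1)),
        v *m gdiff F i = 0 <-> exists w, v = w *m gdiff F i.+1].

(* The image of F_(i+1) lies in (x_1, ..., x_n) F_i. *)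
Definition minimal_complex (K : fieldType) (n : nat) (F : free_complex K n) :
  Prop :=
  forall i a b, (gdiff F i a b)@_0%MM = 0.

(* r = max {j - i | beta_(i,j)(I) <> 0}, the Betti numbers being read off a
   minimal graded free resolution of I; this is the regularity of I as an
   S-module, not that of S/I. *)
Definition has_regularity (K : fieldType) (n : nat)
    (I : {mpoly K[n]} -> Prop) (r : nat) : Prop :=
  exists F : free_complex K n,
    [/\ graded_complex F, resolves F I, minimal_complex F,
        forall i (a : 'I_(grank F i)), (gshift a <= r + i)%N
      & exists i (a : 'I_(grank F i)), gshift a = (r + i)%N].

(* Main.v *)
Require Import Defs.
From Stdlib Require Import Classical ClassicalEpsilon.
From mathcomp Require Import all_boot all_order all_algebra.
From mathcomp Require Import mpoly.
From mathcomp Require Import zify.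

(* Monomial ideals with linear quotients whose generators are listed by
   nondecreasing degree have regularity equal to the largest degree of a
   generator, because the syzygies of such a list again form a list of the same
   kind.  The generators of I^k form a set with the exchange property, so I^k
   has linear quotients and regularity k d.  For the symbolic power, let V be the
   set of variables whose exponent varies on G(I).  If some monomial w satisfies
   x_i w in G(I) for all i in V, then (V) is an associated prime and
   I^(k) = I^k.  In at most three variables the only ideals without such a w are
   the principal ones, where again I^(k) = I^k, and u (xy, xz, yz), whose
   symbolic powers have explicit generators. *)

Set Implicit Arguments.
Unset Strict Implicit.
Unset Printing Implicit Defensive.

Import Order.TTheory GRing.Theory.

(** * Monomial ideals *)

Section Ideals.
Local Open Scope ring_scope.
Variable R : comNzRingType.
Implicit Types (I J A : R -> Prop).

(** Regularity is witnessed by an actual minimal graded resolution, so one has to be built for each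
    ideal. Working with submodules of graded free modules instead of ideals lets the same syzygy
    step be iterated. Each step raises degrees by exactly one, so the largest difference between
    shift and homological index already occurs at index 0; nondecreasing degrees keep constants out
    of the matrices. The associated primes of I are never classified: upper bounds on I^(k) come
    from primes exhibited as annihilators of monomials, and the reverse inclusion for u (xy, xz, yz)
    uses only that every associated prime misses one of x, y, z. The two regularities agree there
    because (u y z)^k is a generator of I^(k) of largest degree. *)

Lemma ideal_gen_ideal A : is_ideal (ideal_gen A).
Proof.
split.
- by exists [::]; rewrite ?big_nil.
- move=> f g [s hs ->] [t ht ->]; exists (s ++ t); last by rewrite big_cat.
  by move=> p; rewrite mem_cat => /orP[/hs|/ht].
- move=> f g [s hs ->]; exists [seq (f * p.1, p.2) | p <- s].
    by move=> p /mapP[q /hs hq ->].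
  by rewrite big_map mulr_sumr; apply: eq_bigr => p _; rewrite mulrA.
Qed.

Lemma ideal_gen_mem A f : A f -> ideal_gen A f.
Proof.
move=> Af; exists [:: (1, f)]; last by rewrite big_seq1 mul1r.
by move=> p; rewrite inE => /eqP->.
Qed.

Lemma ideal_gen_sub A I :
  is_ideal I -> (forall f, A f -> I f) -> forall f, ideal_gen A f -> I f.
Proof.
move=> [I0 ID IM] AI f [s hs ->]; rewrite big_seq.
by apply: (big_ind I) => // p /hs/AI; apply: IM.
Qed.

Lemma ideal_sum I (T : eqType) (s : seq T) (F : T -> R) :
  is_ideal I -> (forall i, i \in s -> I (F i)) -> I (\sum_(i <- s) F i).
Proof. by move=> [I0 ID _] IF; rewrite big_seq; apply: (big_ind I). Qed.

End Ideals.

Section MonomialIdeals.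
Local Open Scope ring_scope.
Variables (K : fieldType) (n : nat).
Implicit Types (f : {mpoly K[n]}) (G H : seq 'X_{1..n}) (m u v : 'X_{1..n}).

Definition mono_in G m := has (fun g => (g <= m)%MM) G.

Lemma mono_inP G m : reflect (exists2 g, g \in G & (g <= m)%MM) (mono_in G m).
Proof. exact: hasP. Qed.

Lemma mono_in_le G m m' : (m <= m')%MM -> mono_in G m -> mono_in G m'.
Proof.
move=> mm' /mono_inP[g gG gm]; apply/mono_inP; exists g => //.
exact: lepm_trans mm'.
Qed.

Lemma supp_cond_ideal (Q : 'X_{1..n} -> Prop) :
  (forall m m', (m <= m')%MM -> Q m -> Q m') ->
  is_ideal (fun f : {mpoly K[n]} => forall m, m \in msupp f -> Q m).
Proof.
move=> Qle; split=> [m|f g Qf Qg m|f g Qg m].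
- by rewrite msupp0.
- by move=> /msuppD_le; rewrite mem_cat => /orP[/Qf|/Qg].
- move=> /msuppM_le /allpairsP[[m1 m2] /= [_ /Qg Qm2 ->]].
  by apply: Qle Qm2; rewrite lem_addl.
Qed.

Lemma monomial_genP G f :
  monomial_gen G f <-> forall m, m \in msupp f -> mono_in G m.
Proof.
split.
  apply: (ideal_gen_sub (supp_cond_ideal (@mono_in_le G))).
  move=> _ [g gG ->] m; rewrite msuppX inE => /eqP->.
  by apply/mono_inP; exists g => //; apply: lepm_refl.
move=> Gf; rewrite [f]mpolyE.
apply: ideal_sum (ideal_gen_ideal _) _ => m /Gf /mono_inP[g gG gm].
have [_ _ GM] := ideal_gen_ideal
  (fun f : {mpoly K[n]} => exists2 m, m \in G & f = 'X_[m]).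
rewrite -(submK gm) mpolyXD scalerAl.
by apply: GM; apply: ideal_gen_mem; exists g.
Qed.

Lemma monomial_gen_ideal G : is_ideal (@monomial_gen K n G).
Proof. exact: ideal_gen_ideal. Qed.

Lemma monomial_genX G m : @monomial_gen K n G 'X_[m] <-> mono_in G m.
Proof.
rewrite monomial_genP msuppX; split=> [->|Gm m']; rewrite ?inE //.
by move/eqP->.
Qed.

Lemma variable_gen_monomial (V : {set 'I_n}) :
  same_ideal (@variable_gen K n V) (monomial_gen [seq U_(i)%MM | i <- enum V]).
Proof.
move=> f; split; apply: (ideal_gen_sub (ideal_gen_ideal _)) => {}f.
- move=> [i iV ->]; apply: ideal_gen_mem; exists U_(i)%MM => //.
  by apply: map_f; rewrite mem_enum.
- case=> _ /mapP[i + ->] ->; rewrite mem_enum => iV.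
  by apply: ideal_gen_mem; exists i.
Qed.

Lemma mono_in_vars (V : {set 'I_n}) m :
  reflect (exists2 i, i \in V & (0 < m i)%N)
    (mono_in [seq U_(i)%MM | i <- enum V] m).
Proof.
rewrite /mono_in has_map; apply: (iffP hasP) => [[i]|[i iV mi]].
  by rewrite mem_enum /= lep1mP -lt0n => iV mi; exists i.
by exists i; rewrite ?mem_enum //= lep1mP -lt0n.
Qed.

Lemma variable_genP (V : {set 'I_n}) f :
  variable_gen V f <->
  forall m, m \in msupp f -> exists2 i, i \in V & (0 < m i)%N.
Proof.
rewrite (variable_gen_monomial V f) monomial_genP.
by split=> Vf m /Vf /mono_in_vars.
Qed.

(** Having one coefficient per variable lets [syz_span] subtract one multiple of a chosen syzygy for
    each variable. *)
Lemma variable_gen_sum (V : {set 'I_n}) f :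
  variable_gen V f -> exists h : 'I_n -> {mpoly K[n]}, f = \sum_(i in V) h i * 'X_i.
Proof.
case=> s hs ->; elim: s hs => [|p s IH] hs.
  by exists (fun=> 0); rewrite big_nil big1 // => i _; rewrite mul0r.
rewrite big_cons; have [q qs|h ->] := IH.
  by apply: hs; rewrite inE qs orbT.
have [i iV ->] := hs p (mem_head _ _).
exists (fun j => h j + (if j == i then p.1 else 0)).
under [RHS]eq_bigr do rewrite mulrDl.
rewrite big_split /= [LHS]addrC; congr (_ + _).
rewrite (bigD1 i) //= eqxx big1 ?addr0 // => j /andP[_ /negPf->].
by rewrite mul0r.
Qed.

Definition msum_pairs G H : seq 'X_{1..n} := [seq (g + h)%MM | g <- G, h <- H].

Definition gpow G k := iter k (msum_pairs G) [:: 0%MM].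

Lemma ideal_mul_monomial (I J : {mpoly K[n]} -> Prop) G H :
  same_ideal I (monomial_gen G) -> same_ideal J (monomial_gen H) ->
  same_ideal (ideal_mul I J) (monomial_gen (msum_pairs G H)).
Proof.
move=> IG JH f; split; apply: ideal_gen_sub (ideal_gen_ideal _) _ f => f.
- case=> g [h [/IG/monomial_genP Gg /JH/monomial_genP Hh ->]].
  apply/monomial_genP => m /msuppM_le /allpairsP[[m1 m2] /= [mg mh ->]].
  have /mono_inP[a aG am] := Gg _ mg; have /mono_inP[b bG bm] := Hh _ mh.
  apply/mono_inP; exists (a + b)%MM; first by apply: allpairs_f.
  apply/mnm_lepP => i; rewrite !mnmDE.
  by apply: leq_add; [move/mnm_lepP: am | move/mnm_lepP: bm].
- case=> _ /allpairsP[[a b] /= [aG bH ->]] ->; apply: ideal_gen_mem.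
  exists 'X_[a], 'X_[b]; split; last by rewrite mpolyXD.
  + by apply/IG/monomial_genX/mono_inP; exists a; rewrite ?lepm_refl.
  + by apply/JH/monomial_genX/mono_inP; exists b; rewrite ?lepm_refl.
Qed.

Lemma ideal_pow_monomial (I : {mpoly K[n]} -> Prop) G k :
  same_ideal I (monomial_gen G) ->
  same_ideal (ideal_pow I k) (monomial_gen (gpow G k)).
Proof.
move=> IG; elim: k => [|k IH]; last exact: ideal_mul_monomial.
move=> f; split=> // _; apply/monomial_genP => m _.
by apply/mono_inP; exists 0%MM; rewrite ?inE //; apply/mnm_lepP => i; rewrite mnm0E.
Qed.

Definition antichain G := forall u v, u \in G -> v \in G -> (u <= v)%MM -> u = v.

Lemma min_monomial_gens_antichain (L : {mpoly K[n]} -> Prop) G :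
  uniq G -> antichain G -> same_ideal L (monomial_gen G) -> min_monomial_gens L G.
Proof.
move=> uG aG LG; split=> // G' sG' LG' u uG'.
have /LG/LG'/monomial_genX/mono_inP[v vG' vu] : @monomial_gen K n G 'X_[u].
  by apply/monomial_genX/mono_inP; exists u => //; apply: lepm_refl.
by rewrite -(aG v u (sG' _ vG') uG' vu).
Qed.

Lemma lem_mdeg u v : (u <= v)%MM -> (mdeg v <= mdeg u)%N -> u = v.
Proof.
move=> uv dvu; have := submK uv => E; have := congr1 mdeg E.
rewrite mdegD => E'; have /eqP : mdeg (v - u)%MM = 0%N by lia.
by rewrite mdeg_eq0 => /eqP E2; rewrite -E E2 add0m.
Qed.

Lemma monomial_gen_eqmem G H :
  G =i H -> same_ideal (@monomial_gen K n G) (monomial_gen H).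
Proof.
move=> GH f; rewrite !monomial_genP.
by split=> Gf m /Gf /mono_inP[g gG gm]; apply/mono_inP; exists g; rewrite // ?GH// -GH.
Qed.

End MonomialIdeals.

(** * Resolutions by iterated syzygies *)

Section HomogeneousParts.
Local Open Scope ring_scope.
Variables (K : fieldType) (n : nat).
Implicit Types (p a : {mpoly K[n]}) (d e : nat).

(* The part of p of degree d, the generator that p multiplies having degree e. *)
Definition hpart d e p : {mpoly K[n]} :=
  \sum_(m <- msupp p | (mdeg m + e == d)%N) p@_m *: 'X_[m].

Lemma mcoeff_hpart d e p m :
  (hpart d e p)@_m = if (mdeg m + e == d)%N then p@_m else 0.
Proof.
rewrite /hpart raddf_sum /=.
under eq_bigr do rewrite mcoeffZ mcoeffX.
have [mp|mNp] := boolP (m \in msupp p); last first.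
  rewrite (memN_msupp_eq0 mNp) if_same big_seq_cond big1 // => m' /andP[m'p _].
  case: eqP => [E|_]; last by rewrite mulr0.
  by rewrite -E m'p in mNp.
rewrite big_mkcond (bigD1_seq m) ?msupp_uniq //= eqxx mulr1 big1 ?addr0 //.
by move=> m' /negPf->; rewrite mulr0 if_same.
Qed.

Lemma hpartD d e p q : hpart d e (p + q) = hpart d e p + hpart d e q.
Proof.
by apply/mpolyP => m; rewrite mcoeffD !mcoeff_hpart mcoeffD; case: ifP; rewrite ?addr0.
Qed.

Lemma hpart_sum (T : Type) (s : seq T) d e (F : T -> {mpoly K[n]}) :
  hpart d e (\sum_(i <- s) F i) = \sum_(i <- s) hpart d e (F i).
Proof.
apply: (big_morph (hpart d e)); first exact: hpartD.
by apply/mpolyP => m; rewrite mcoeff_hpart mcoeff0 if_same.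
Qed.

Lemma hpart_id d e p :
  (forall m, m \in msupp p -> (mdeg m + e)%N = d) -> hpart d e p = p.
Proof.
move=> H; apply/mpolyP => m; rewrite mcoeff_hpart; case: eqP => // Hm.
by rewrite memN_msupp_eq0 //; apply/negP => /H.
Qed.

Lemma hpart_eq0 d e p :
  (forall m, m \in msupp p -> (mdeg m + e)%N <> d) -> hpart d e p = 0.
Proof.
move=> H; apply/mpolyP => m; rewrite mcoeff_hpart mcoeff0; case: eqP => // Hm.
by rewrite memN_msupp_eq0 //; apply/negP => /H.
Qed.

Lemma msupp_hpart d e p m :
  m \in msupp (hpart d e p) -> (mdeg m + e)%N = d.
Proof. by rewrite mcoeff_msupp mcoeff_hpart; case: ifP => [/eqP|]; rewrite ?eqxx. Qed.

(** Here a is homogeneous of degree e' - e, so the terms of p outside degree d - e' contribute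
    nothing to the product in degree d - e. *)
Lemma hpartM d e e' p a :
  (forall m, m \in msupp a -> (mdeg m + e)%N = e') ->
  hpart d e (p * a) = hpart d e' p * a.
Proof.
move=> Ha; have -> : p * a = hpart d e' p * a + (p - hpart d e' p) * a.
  by rewrite -mulrDl addrCA subrr addr0.
rewrite hpartD hpart_id => [|m].
  rewrite [X in _ + X]hpart_eq0 ?addr0 // => m.
  move=> /msuppM_le /allpairsP[[m1 m2] /= [m1p /Ha m2a ->]].
  move: m1p; rewrite mcoeff_msupp mcoeffB mcoeff_hpart mdegD.
  by case: ifP => [_|/eqP H _]; [rewrite subrr eqxx | lia].
move=> /msuppM_le /allpairsP[[m1 m2] /= [/msupp_hpart m1p /Ha m2a ->]].
by rewrite mdegD; lia.
Qed.

End HomogeneousParts.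

(** * Syzygies of modules with variable colon ideals *)

Section Stages.
Local Open Scope ring_scope.

Lemma mulmx_comb_eq0 (S : comNzRingType) p q r (x y : 'M[S]_(p, q))
    (A : 'M[S]_(q, r)) (a b : S) :
  x *m A = 0 -> y *m A = 0 -> (a *: x - b *: y) *m A = 0.
Proof. by move=> xA yA; rewrite mulmxBl -!scalemxAl xA yA !scaler0 subrr. Qed.

Variables (K : fieldType) (n : nat).
Local Notation R := {mpoly K[n]}.

(* A submodule of a graded free module generated by the rows of [gens], where the
   rows are ordered by [key] and, for each row j, the colon ideal of the earlier
   rows by row j is generated by the variables in [cvars j].  Its syzygy module is
   again of this form: for v in [cvars j] pick a syzygy z_(j,v) = x_v e_j + (earlier
   terms), ordered lexicographically by (j, v); reading off the j-th coordinate
   shows that the colon ideal at (j, v) is generated by the v' < v in [cvars j]. *)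
Record stage := Stage {
  ng : nat; amb : nat;
  gens : 'M[R]_(ng, amb);
  adeg : 'I_amb -> nat;
  gdeg : 'I_ng -> nat;
  key : 'I_ng -> nat;
  cvars : 'I_ng -> {set 'I_n} }.

Definition before (st : stage) (N : nat) (c : 'rV[R]_(ng st)) :=
  forall l, (N <= key l)%N -> c 0 l = 0.
Arguments before : clear implicits.

(** [good_colon] and [good_var] are the two inclusions describing the colon ideal at row j.
    [good_key] lets rows be eliminated one at a time, and [good_deg] yields minimality of the
    resolution. *)
Record good (st : stage) : Prop := Good {
  good_graded : forall j b m,
    m \in msupp (gens st j b) -> (mdeg m + adeg b)%N = gdeg j;
  good_colon : forall j f c,
    before st (key j) c -> f *: row j (gens st) = c *m gens st ->
    variable_gen (cvars j) f;
  good_var : forall j v, v \in cvars j ->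
    exists2 c, before st (key j) c & 'X_v *: row j (gens st) = c *m gens st;
  good_key : injective (@key st);
  good_deg : forall j l : 'I_(ng st), (key l < key j)%N -> (gdeg l <= gdeg j)%N }.

Definition syz_spec (st : stage) (j : 'I_(ng st)) (v : 'I_n) (z : 'rV[R]_(ng st)) :=
  [/\ z 0 j = 'X_v,
      before st (key j).+1 (z - 'X_v *: delta_mx 0 j),
      z *m gens st = 0 &
      forall l m, m \in msupp (z 0 l) -> (mdeg m + gdeg l)%N = (gdeg j).+1].

(** Meaningful only for v in [cvars j]; [syz_stage] ranges over exactly those pairs. *)
Definition syz (st : stage) (j : 'I_(ng st)) (v : 'I_n) : 'rV[R]_(ng st) :=
  epsilon (inhabits 0) (syz_spec j v).

(** Since v < n, the key [key j * n + v] encodes the lexicographic order on pairs. *)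
Definition syz_stage (st : stage) : stage :=
  let ps := [set p : 'I_(ng st) * 'I_n | p.2 \in cvars p.1] in
  @Stage #|ps| (ng st)
    (\matrix_(a, b) syz (enum_val a).1 (enum_val a).2 0 b)
    (@gdeg st)
    (fun a => (gdeg (enum_val a).1).+1)
    (fun a => key (enum_val a).1 * n + (enum_val a).2)%N
    (fun a => [set v in cvars (enum_val a).1 | (v < (enum_val a).2)%N]).

Section SyzygyStage.
Variables (st : stage) (gst : good st).
Local Notation A := (gens st).
Local Notation ps := [set p : 'I_(ng st) * 'I_n | p.2 \in cvars p.1].

Lemma syzP (j : 'I_(ng st)) v : v \in cvars j -> syz_spec j v (syz j v).
Proof.
move=> vj; apply: epsilon_spec.
have [c cj cE] := good_var gst vj.
pose d := (gdeg j).+1.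
(* The relation from [good_var] need not be homogeneous; its component of degree d still represents
   x_v times row j, which is homogeneous of that degree. *)
pose c' : 'rV[R]_(ng st) := \row_l hpart d (gdeg l) (c 0 l).
have c'E : 'X_v *: row j A = c' *m A.
  apply/rowP => b; rewrite !mxE.
  under eq_bigr => l _.
    rewrite mxE -(@hpartM _ _ d (adeg b)); last by move=> m; apply: good_graded.
    over.
  rewrite -hpart_sum; move/rowP/(_ b): cE; rewrite !mxE => <-.
  rewrite hpart_id // => m /msuppM_le /allpairsP[[m1 m2] /= [+ m2A ->]].
  rewrite msuppX inE => /eqP->.
  by rewrite mdegD mdeg1 -addnA (good_graded gst m2A).
have c'j : before st (key j) c'.
  by move=> l jl; rewrite mxE cj // hpart_eq0 // => m; rewrite msupp0.
exists ('X_v *: delta_mx 0 j - c'); split.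
- by rewrite !mxE !eqxx mulr1 cj // hpart_eq0 ?subr0 // => m; rewrite msupp0.
- by move=> l jl; rewrite addrAC subrr add0r mxE c'j ?oppr0 // ltnW.
- by rewrite mulmxBl -scalemxAl -rowE c'E subrr.
- move=> l m; rewrite !mxE eqxx /=; have [->|lj] := eqVneq l j.
    rewrite mulr1 cj // hpart_eq0 ?subr0 => [|m']; last by rewrite msupp0.
    by rewrite msuppX inE => /eqP->; rewrite mdeg1.
  rewrite mulr0 sub0r (perm_mem (msuppN _)).
  exact: msupp_hpart.
Qed.

Lemma syz_gt (j l : 'I_(ng st)) v : v \in cvars j -> (key j < key l)%N -> syz j v 0 l = 0.
Proof.
move=> vj jl; have [_ + _ _] := syzP vj => /(_ l jl); rewrite !mxE eqxx /=.
by case: eqP jl => [->|_]; rewrite ?ltnn // mulr0 subr0.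
Qed.

(* The Koszul relation between x_u and x_v loses its j-th coordinate. *)
Lemma syz_koszul (j : 'I_(ng st)) u v :
  u \in cvars j -> v \in cvars j ->
  let c := 'X_v *: syz j u - 'X_u *: syz j v in
  before st (key j) c /\ c *m A = 0.
Proof.
move=> uj vj c.
have [Ev _ Av _] := syzP vj; have [Eu _ Au _] := syzP uj; split.
  move=> l; rewrite leq_eqVlt => /orP[/eqP/(good_key gst)<-|lj].
    by rewrite mxE [X in X + _]mxE Eu mxE mxE Ev mulrC subrr.
  rewrite mxE [X in X + _]mxE (syz_gt uj lj) mxE mxE (syz_gt vj lj).
  by rewrite !mulr0 subrr.
have H := @mulmx_comb_eq0 R _ _ _ _ _ A 'X_v 'X_u Au Av.
exact H.
Qed.

Lemma syz_stage_comb (h : 'I_(ng st) * 'I_n -> R) :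
  (\row_a h (enum_val a)) *m gens (syz_stage st) = \sum_(p in ps) h p *: syz p.1 p.2.
Proof.
rewrite mulmx_sum_row [RHS]big_enum_val.
apply: eq_bigr => a _; rewrite !mxE; congr (_ *: _).
by apply/rowP => b; rewrite !mxE.
Qed.

Lemma syz_stage_comb1 (j : 'I_(ng st)) (h : 'I_n -> R) :
  (\row_(a < ng (syz_stage st)) (if (enum_val a).1 == j then h (enum_val a).2 else 0))
    *m gens (syz_stage st) = \sum_(v in cvars j) h v *: syz j v.
Proof.
rewrite (syz_stage_comb (fun p => if p.1 == j then h p.2 else 0)).
rewrite (eq_bigl (fun p => xpredT p.1 && (p.2 \in cvars p.1))) => [|p]; last by rewrite inE.
rewrite -(pair_big_dep xpredT (fun i v => v \in cvars i)
  (fun i v => (if i == j then h v else 0) *: syz i v)) /=.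
rewrite (bigD1 j) //= eqxx [X in _ + X]big1 ?addr0 // => i /negPf ij.
by rewrite big1 // => v _; rewrite ij scale0r.
Qed.

(** Elimination from the top: the coordinate at the last row lies in the colon ideal there, so a
    combination of the chosen syzygies cancels it without touching later rows. The bound on w is
    recorded because [good_var] at the next stage asks for a combination of earlier generators. *)
Lemma syz_span N (c : 'rV[R]_(ng st)) :
  c *m A = 0 -> before st N c ->
  exists2 w, c = w *m gens (syz_stage st) &
    forall a : 'I_(ng (syz_stage st)), (N <= key (enum_val a).1)%N -> w 0 a = 0.
Proof.
elim: N c => [|N IH] c cA cN.
  exists 0; last by move=> a _; rewrite mxE.
  by rewrite mul0mx; apply/rowP => l; rewrite mxE cN.
have [|Nkey] := pickP (fun l : 'I_(ng st) => key l == N); last first.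
  have [|w -> wN] := IH c cA.
    move=> l; rewrite leq_eqVlt => /orP[/eqP E|]; last exact: cN.
    by have := Nkey l; rewrite -E eqxx.
  by exists w => // a /ltnW; apply: wN.
move=> j /eqP keyj.
have /variable_gen_sum[h hE] : variable_gen (cvars j) (c 0 j).
  (* As c A = 0, c_j times row j is minus the contribution of the earlier rows. *)
  apply: (@good_colon _ gst j _ (c 0 j *: delta_mx 0 j - c)) => [l jl|].
    rewrite !mxE eqxx /=; have [->|lj] := eqVneq l j; first by rewrite mulr1 subrr.
    rewrite mulr0 sub0r cN ?oppr0 // ltn_neqAle -keyj jl andbT.
    by rewrite (inj_eq (good_key gst)) eq_sym.
  by rewrite mulmxBl cA subr0 -scalemxAl -rowE.
pose c' := c - \sum_(v in cvars j) h v *: syz j v.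
have c'A : c' *m A = 0.
  rewrite mulmxBl cA sub0r mulmx_suml big1 ?oppr0 // => v vj.
  by have [_ _ E _] := syzP vj; rewrite -scalemxAl E scaler0.
have c'N : before st N c'.
  move=> l; rewrite !mxE summxE; have [->|lj] := eqVneq l j.
    move=> _; rewrite hE -sumrB big1 // => v vj.
    by have [E _ _ _] := syzP vj; rewrite mxE E subrr.
  move=> Nl; have {}Nl : (N < key l)%N.
    by rewrite ltn_neqAle Nl andbT -keyj (inj_eq (good_key gst)) eq_sym.
  rewrite cN // sub0r big1 ?oppr0 // => v vj.
  by rewrite mxE syz_gt ?keyj // mulr0.
have [w wE wN] := IH c' c'A c'N.
exists (w + \row_a (if (enum_val a).1 == j then h (enum_val a).2 else 0)).
  by rewrite mulmxDl -wE syz_stage_comb1 subrK.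
move=> a aN; rewrite !mxE wN; last exact: ltnW.
by case: eqP aN => [->|_ _]; rewrite ?addr0 // keyj ltnn.
Qed.

Lemma row_syz_stage a : row a (gens (syz_stage st)) = syz (enum_val a).1 (enum_val a).2.
Proof. by apply/rowP => b; rewrite !mxE. Qed.

Lemma syz_stage_exact (c : 'rV[R]_(ng st)) :
  c *m A = 0 <-> exists w, c = w *m gens (syz_stage st).
Proof.
split=> [cA|[w ->]].
  have cN : before st (\max_(l < ng st) key l).+1 c.
    by move=> l; rewrite ltnNge (leq_bigmax l).
  by have [w wE _] := syz_span cA cN; exists w.
rewrite -mulmxA; have -> : gens (syz_stage st) *m A = 0.
  apply/row_matrixP => a; rewrite row_mul row0.
  by rewrite row_syz_stage; have := enum_valP a; rewrite inE => /syzP [_ _ -> _].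
by rewrite mulmx0.
Qed.

Lemma syz_stage_cvars (a : 'I_(ng (syz_stage st))) :
  (enum_val a).2 \in cvars (enum_val a).1.
Proof. by have := enum_valP a; rewrite inE. Qed.

Lemma syz_stage_key_lt (a b : 'I_(ng (syz_stage st))) :
  (key b < key a)%N =
  (key (enum_val b).1 < key (enum_val a).1)%N ||
  ((enum_val b).1 == (enum_val a).1) && ((enum_val b).2 < (enum_val a).2)%N.
Proof.
rewrite -(inj_eq (good_key gst)) /=.
have := ltn_ord (enum_val a).2; have := ltn_ord (enum_val b).2.
move: (key _) (key _) (nat_of_ord _) (nat_of_ord _) => ka kb va vb.
nia.
Qed.

Lemma syz_stage_good : good (syz_stage st).
Proof.
split.
- move=> a b m; rewrite mxE => mz.
  by have [_ _ _ H] := syzP (syz_stage_cvars a); apply: H.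
- move=> a f c ca /rowP/(_ (enum_val a).1).
  have [E _ _ _] := syzP (syz_stage_cvars a).
  rewrite row_syz_stage mxE E mulmx_sum_row summxE => H.
  apply/variable_genP => m mf.
  (* Write a = (j, u). At coordinate j an earlier generator contributes 0 if its first index
     precedes j, and a multiple of x_v with v < u otherwise. So some such x_v divides m x_u, hence
     m. *)
  have : (m + U_((enum_val a).2))%MM \in msupp (f * 'X_(enum_val a).2).
    by rewrite mcoeff_msupp addmC mcoeffMX -mcoeff_msupp.
  rewrite H => /msupp_sum_le.
  case/flatten_mapP => b _; rewrite mxE row_syz_stage.
  have [ab|] := leqP (key a) (key b); first by rewrite ca // mul0r msupp0.
  rewrite syz_stage_key_lt => /orP[ba|/andP[/eqP Eba ba]].
    by rewrite (syz_gt (syz_stage_cvars b) ba) mulr0 msupp0.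
  have [+ _ _ _] := syzP (syz_stage_cvars b); rewrite Eba => ->.
  move=> /msuppM_le /allpairsP[[m1 m2] /= [_ + /mnmP/(_ (enum_val b).2)]].
  rewrite msuppX inE => /eqP->.
  rewrite !mnmDE !mnm1E eqxx; case: (eqVneq (enum_val a).2 _) => [E2|_].
    by move: ba; rewrite E2 ltnn.
  move=> Em; exists (enum_val b).2; last by lia.
  by rewrite inE -Eba syz_stage_cvars.
- move=> a v; rewrite inE => /andP[va lt_v].
  set j := (enum_val a).1 in va *; set u := (enum_val a).2 in lt_v *.
  have uj : u \in cvars j := syz_stage_cvars a.
  pose c := 'X_v *: syz j u - 'X_u *: syz j v.
  have [cj cA] := syz_koszul uj va.
  (* The Koszul combination is spanned by generators whose first index precedes j. Adding x_u
     z_(j,v) back, which comes before (j, u) because v < u, expresses x_v z_(j,u). *)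
  have [w wE wN] := syz_span cA cj.
  exists (w + \row_b (if (enum_val b).1 == j then
                       if (enum_val b).2 == v then 'X_u else 0 else 0)).
    move=> b; rewrite leqNgt syz_stage_key_lt negb_or -leqNgt => /andP[ab Nab].
    rewrite !mxE wN // add0r; case: eqP => // Eb; case: eqP => // Ev.
    by move: Nab; rewrite -/j -/u Eb Ev eqxx lt_v.
  have sumE : \sum_(x in cvars j) (if x == v then 'X_u else 0) *: syz j x =
      'X_u *: syz j v.
    rewrite (bigD1 v) //= eqxx big1 => [|x /andP[_ /negPf->]]; last exact: scale0r.
    exact: addr0.
  rewrite mulmxDl -wE (syz_stage_comb1 j (fun x => if x == v then 'X_u else 0)) sumE.
  rewrite row_syz_stage; exact: (esym (subrK ('X_u *: syz j v) ('X_v *: syz j u))).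
- move=> a b E; apply/enum_val_inj.
  have := syz_stage_key_lt a b; have := syz_stage_key_lt b a; rewrite E ltnn.
  move=> /esym/norP[ba Nba] /esym/norP[ab Nab].
  have E1 : (enum_val a).1 = (enum_val b).1 by apply: (good_key gst); lia.
  rewrite [enum_val a]surjective_pairing [enum_val b]surjective_pairing E1.
  congr (_, _); apply: val_inj => /=; move: Nab Nba; rewrite E1 eqxx /=; lia.
- move=> a b; rewrite syz_stage_key_lt /= ltnS => /orP[/(good_deg gst)//|].
  by case/andP => /eqP->.
Qed.

End SyzygyStage.
End Stages.

(** * Resolutions of ideals with linear quotients *)

Section Resolution.
Local Open Scope ring_scope.
Variables (K : fieldType) (n : nat).
Local Notation R := {mpoly K[n]}.

Definition resolution (st : stage K n) (aug : 'cV[R]_(ng st)) :=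
  @FreeComplex K n (fun i => ng (iter i (@syz_stage K n) st))
    (fun i => @gdeg _ _ (iter i (@syz_stage K n) st)) aug
    (fun i => gens (syz_stage (iter i (@syz_stage K n) st))).

Lemma iter_syz_stage_good (st : stage K n) i : good st -> good (iter i (@syz_stage K n) st).
Proof. by move=> gst; elim: i => //= i; apply: syz_stage_good. Qed.

Lemma iter_syz_stage_deg (st : stage K n) r i :
  (forall a : 'I_(ng st), (gdeg a <= r)%N) ->
  forall a : 'I_(ng (iter i (@syz_stage K n) st)), (gdeg a <= r + i)%N.
Proof.
move=> H; elim: i => [|i IH] a; first by rewrite addn0.
by rewrite addnS ltnS; apply: IH.
Qed.

(** A constant entry at b would force [gdeg b = (gdeg j).+1], but z_(j,v) involves only rows up to
    j, of degree at most [gdeg j]. *)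
Lemma syz_stage_minimal (st : stage K n) (a : 'I_(ng (syz_stage st))) b :
  good st -> (gens (syz_stage st) a b)@_0%MM = 0.
Proof.
move=> gst; apply/eqP; rewrite mcoeff_eq0; apply/negP => H.
have /= E := good_graded (syz_stage_good gst) H; rewrite mdeg0 add0n in E.
move: H; rewrite mxE; have [ab|] := ltnP (key (enum_val a).1) (key b).
  by rewrite (syz_gt gst (syz_stage_cvars a) ab) msupp0.
rewrite leq_eqVlt => /orP[/eqP/(good_key gst) Eb|/(good_deg gst)].
  by move: E; rewrite Eb => /n_Sn.
by rewrite E ltnn.
Qed.

(* Linear quotients for the order of [mpoly] on monomials, which compares degrees
   first. *)
Definition deglex_lq (G : seq 'X_{1..n}) :=
  forall u v, u \in G -> v \in G -> (v < u)%O ->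
  exists2 j, (u j < v j)%N &
    exists2 w, w \in G & ((w < u)%O && (w <= U_(j) + u)%MM).

Section Sorted.
Variable us : seq 'X_{1..n}.
Hypotheses (us_sorted : sorted <%O us) (us_lq : deglex_lq us).
Local Notation us_ j := (nth 0%MM us j).

Lemma us_lt i j : (i < size us)%N -> (j < size us)%N ->
  (us_ i < us_ j)%O = (i < j)%N.
Proof. exact: (lt_sorted_ltn_nth 0%MM us_sorted). Qed.

(** The variables generating the colon ideal by u of the generators preceding u. *)
Definition lq_vars u : {set 'I_n} :=
  [set v | has (fun w => (w < u)%O && (w <= U_(v) + u)%MM) us].

Definition monomial_stage : stage K n :=
  @Stage K n (size us) 1 (\matrix_(j, _) 'X_[us_ j]) (fun=> 0%N)
    (fun j => mdeg (us_ j)) (@nat_of_ord _) (fun j => lq_vars (us_ j)).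

Lemma lq_colon u m w :
  u \in us -> w \in us -> (w < u)%O -> (w <= m + u)%MM ->
  exists2 v, v \in lq_vars u & (0 < m v)%N.
Proof.
move=> uu wu ltwu /mnm_lepP le; have [v uv [w' w'u Hw']] := us_lq uu wu ltwu.
exists v; last by have := le v; rewrite mnmDE; lia.
by rewrite inE; apply/hasP; exists w'.
Qed.

Lemma monomial_stage_good : good monomial_stage.
Proof.
split.
- move=> j b m; rewrite mxE msuppX inE => /eqP->.
  by rewrite addn0.
- move=> j f c cj /rowP/(_ 0); rewrite !mxE => H.
  apply/variable_genP => m mf.
  have : (us_ j + m)%MM \in msupp (f * 'X_[us_ j]).
    by rewrite mcoeff_msupp mcoeffMX -mcoeff_msupp.
  rewrite H => /msupp_sum_le /flatten_mapP[l _]; rewrite mxE.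
  have [jl|lj] := leqP j l; first by rewrite cj // mul0r msupp0.
  move=> /msuppM_le /allpairsP[[m1 m2] /= [_ + E]].
  rewrite msuppX inE => /eqP E2.
  apply: (@lq_colon (us_ j) m (us_ l)); rewrite ?mem_nth ?us_lt //.
  by rewrite addmC E E2 lem_addl.
- move=> j v; rewrite inE => /hasP[w wu /andP[wj le]].
  have lt_iw : (index w us < size us)%N by rewrite index_mem.
  pose l := Ordinal lt_iw; have El : us_ l = w by rewrite nth_index.
  exists ('X_[U_(v) + us_ j - w] *: delta_mx 0 l).
    have lj : (l < j)%N by rewrite -us_lt ?ltn_ord // El.
    move=> i /= ji; rewrite !mxE eqxx /=; case: eqP ji => [->|_ _].
      by rewrite leqNgt lj.
    by rewrite mulr0.
  apply/rowP => b; rewrite -scalemxAl -rowE !mxE.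
  by rewrite -!mpolyXD El submK.
- exact: ord_inj.
- by move=> j l lj; apply: lemc_mdeg; rewrite ltW // us_lt.
Qed.

Lemma resolution_regularity (L : R -> Prop) r :
  same_ideal L (monomial_gen us) ->
  (forall u, u \in us -> (mdeg u <= r)%N) ->
  (exists2 u, u \in us & mdeg u = r) ->
  has_regularity L r.
Proof.
move=> LG le_r [u0 u0u deg_u0]; have g0 := monomial_stage_good.
exists (@resolution monomial_stage (gens monomial_stage)).
have gi i := iter_syz_stage_good i g0.
split.
- split=> [a m|i a b m].
    by move/(good_graded g0); rewrite addn0.
  exact: (good_graded (syz_stage_good (gi i))).
- split=> [f|v|i v]; last 2 first.
  + exact: (syz_stage_exact g0).
  + exact: (syz_stage_exact (gi i.+1)).
  rewrite LG; split.
    case=> s sG ->.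
    elim: s sG => [|p s IH] sG.
      by exists 0; rewrite big_nil mul0mx mxE.
    have [|v vE] := IH; first by move=> q qs; apply: sG; rewrite inE qs orbT.
    have [u uu pE] := sG p (mem_head _ _).
    have lt_u : (index u us < size us)%N by rewrite index_mem.
    exists (v + p.1 *: delta_mx 0 (Ordinal lt_u)).
    rewrite big_cons vE mulmxDl [RHS]mxE addrC; congr (_ + _).
    by rewrite -scalemxAl -rowE !mxE /= nth_index // pE.
  move=> [v ->]; rewrite mxE; apply: ideal_sum; first exact: monomial_gen_ideal.
  move=> j _; have [_ _ MG] := @monomial_gen_ideal K n us; apply: MG.
  rewrite mxE; apply/monomial_genX/mono_inP.
  by exists (us_ j); rewrite ?mem_nth // lepm_refl.
- by move=> i a b; exact: syz_stage_minimal (gi i).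
- move=> i a; apply: iter_syz_stage_deg => {}a.
  by apply: le_r; rewrite mem_nth.
- have lt_i : (index u0 us < size us)%N by rewrite index_mem.
  by exists 0%N, (Ordinal lt_i); rewrite /= nth_index // addn0.
Qed.

Lemma sorted_linear_quotients (L : R -> Prop) :
  min_monomial_gens L us -> has_linear_quotients L.
Proof.
move=> Lus; exists us => // i /andP[i0 ius].
exists (lq_vars (us_ i)) => f.
have takeE w : (w \in take i us) = (w \in us) && (w < us_ i)%O.
  have [wu|wNu] := boolP (w \in us); last by apply/negP => /mem_take; apply/negP.
  by rewrite in_take // -[X in (X < _)%O](nth_index 0%MM wu) us_lt ?index_mem.
rewrite variable_genP; split.
  move=> H m mf.
  have uu : @monomial_gen K n [:: us_ i] 'X_[us_ i].
    by apply: ideal_gen_mem; exists (us_ i); rewrite ?mem_head.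
  have /monomial_genP Hm := H _ uu.
  have : (us_ i + m)%MM \in msupp (f * 'X_[us_ i]).
    by rewrite mcoeff_msupp mcoeffMX -mcoeff_msupp.
  move=> /Hm/mono_inP[w]; rewrite takeE addmC => /andP[wu ltw].
  by apply: lq_colon => //; apply: mem_nth.
move=> H g /monomial_genP Gg; apply/monomial_genP.
move=> _ /msuppM_le /allpairsP[[m1 m2] /= [m1f m2g ->]].
have /mono_inP[u + um2] := Gg _ m2g; rewrite inE => /eqP Eu.
have [v + m1v] := H _ m1f; rewrite inE => /hasP[w wu /andP[ltw lew]].
apply/mono_inP; exists w; first by rewrite takeE wu ltw.
apply: (lepm_trans lew); apply/mnm_lepP => x; rewrite !mnmDE mnm1E.
have /mnm_lepP/(_ x) := um2; rewrite Eu.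
by case: eqP => [<-|_]; lia.
Qed.

End Sorted.

End Resolution.

Lemma deglex_lq_regularity (K : fieldType) n (L : {mpoly K[n]} -> Prop) G r :
  antichain G -> deglex_lq G -> same_ideal L (monomial_gen G) ->
  (forall u, u \in G -> (mdeg u <= r)%N) -> (exists2 u, u \in G & mdeg u = r) ->
  has_regularity L r /\ has_linear_quotients L.
Proof.
move=> aG lqG LG le_r [u0 u0G deg_u0].
pose us := sort <=%O (undup G).
have usE : us =i G by move=> u; rewrite mem_sort mem_undup.
have us_sorted : sorted <%O us.
  by rewrite lt_sorted_uniq_le sort_uniq undup_uniq sort_le_sorted.
have us_lq : deglex_lq us.
  move=> u v; rewrite !usE => uG vG vu; have [j uv [w wG H]] := lqG _ _ uG vG vu.
  by exists j => //; exists w; rewrite ?usE.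
have Lus : same_ideal L (monomial_gen us).
  by move=> f; rewrite (LG f); apply: monomial_gen_eqmem => u; rewrite usE.
split.
  apply: (resolution_regularity us_sorted us_lq Lus) => [u|].
    by rewrite usE => /le_r.
  by exists u0; rewrite ?usE.
apply: (sorted_linear_quotients us_sorted us_lq).
apply: min_monomial_gens_antichain Lus; first by rewrite sort_uniq undup_uniq.
by move=> u v; rewrite !usE; apply: aG.
Qed.

(** * Powers of polymatroidal ideals *)

Section Exchange.
Variable n : nat.
Implicit Types (G H : seq 'X_{1..n}) (u v a : 'X_{1..n}).

Definition exchange G := forall u v, u \in G -> v \in G ->
  forall i, (v i < u i)%N ->
  exists2 j, (u j < v j)%N & (U_(j) + (u - U_(i)))%MM \in G.

(** In equal degree, v < u means v_i < u_i at the first index i where they differ. Exchange at i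
    returns some j > i, so x_j u / x_i is smaller than u and divides x_j u. *)
Lemma exchange_deglex_lq G d :
  (forall u, u \in G -> mdeg u = d) -> exchange G -> deglex_lq G.
Proof.
move=> degG exG u v uG vG.
have deg_uv : mdeg v = mdeg u by rewrite !degG.
move=> /(ltmcP deg_uv)[i lt_i vui].
have [j uvj wG] := exG u v uG vG i vui; exists j => //.
exists (U_(j) + (u - U_(i)))%MM => //; apply/andP; split; last first.
  by apply/mnm_lepP => x; rewrite !mnmDE mnmBE leq_add2l leq_subr.
have ij : (i < j)%N.
  by case: (ltngtP i j) => // [/lt_i|/val_inj] E; move: uvj vui; rewrite ?E; lia.
have deg_w : mdeg (U_(j) + (u - U_(i)))%MM = mdeg u by rewrite !degG.
apply/(ltmcP deg_w); exists i => [x xi|]; rewrite !mnmDE !mnmBE !mnm1E.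
  by rewrite -!val_eqE /= !gtn_eqF ?subn0 // (ltn_trans xi).
by rewrite eqxx -val_eqE /= gtn_eqF // add0n; lia.
Qed.

(** The degree of a / gcd(a, v). *)
Definition excess a v := (\sum_x (a x - v x))%N.

Lemma excess_lt a v j k : (v j < a j)%N -> (a k < v k)%N ->
  (excess (U_(k) + (a - U_(j)))%MM v < excess a v)%N.
Proof.
move=> vaj avk; rewrite /excess (bigD1 j) //= [X in (_ < X)%N](bigD1 j) //=.
rewrite -addSn; apply: leq_add.
  rewrite mnmDE mnmBE !mnm1E eqxx; case: eqP avk vaj => [->|_]; lia.
apply: leq_sum => x xj; rewrite mnmDE mnmBE !mnm1E.
by case: eqP avk => [->|_]; case: (_ == _) => /=; lia.
Qed.

(* Start from u = u1 + u2 and repeatedly exchange in one of the two summands, towards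
   v1 or v2, at the index j that was added last: the sum stays of the form
   u - e_i + e_j, the distance to (v1, v2) drops, and the walk stops at an index j
   with u_j < v_j. *)
Lemma exchange_msum G H : exchange G -> exchange H -> exchange (msum_pairs G H).
Proof.
move=> exG exH u v uGH /allpairsP[[v1 v2] /= [v1G v2H vE]] i vui.
suff walk N : forall a1 a2 j, a1 \in G -> a2 \in H ->
    (excess a1 v1 + excess a2 v2 < N)%N -> (a1 + a2 + U_(i) = u + U_(j))%MM ->
    exists2 k, (u k < v k)%N & (U_(k) + (u - U_(i)))%MM \in msum_pairs G H.
  have /allpairsP[[u1 u2] /= [u1G u2H uE]] := uGH.
  by apply: (walk _ u1 u2 i u1G u2H (leqnn _)); rewrite uE.
elim: N => // N IH a1 a2 j a1G a2H leN aE.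
have aEx x : (a1 x + a2 x + (i == x) = u x + (j == x))%N.
  by have /mnmP/(_ x) := aE; rewrite !mnmDE !mnm1E.
have [uvj|vuj] := ltnP (u j) (v j).
  exists j => //; apply/allpairsP; exists (a1, a2); split=> //=.
  apply/mnmP => x; rewrite !mnmDE mnmBE !mnm1E; have := aEx x.
  by case: (eqVneq i x) vui => [->|_] /=; lia.
(* The exponent of a1 + a2 at j is u_j + 1, or u_i when j = i; either way it exceeds v_j. *)
have : (v1 j < a1 j)%N \/ (v2 j < a2 j)%N.
  have := aEx j; rewrite eqxx; move: vuj vui; rewrite vE !mnmDE.
  by case: (eqVneq i j) => [->|_] /=; lia.
case=> lt_j.
- have [k lt_k a1'] := exG a1 v1 a1G v1G j lt_j.
  apply: (IH _ a2 k a1' a2H); first by have := excess_lt lt_j lt_k; lia.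
  apply/mnmP => x; rewrite !mnmDE mnmBE !mnm1E; have := aEx x.
  by case: (eqVneq j x) lt_j => [->|_] /=; lia.
- have [k lt_k a2'] := exH a2 v2 a2H v2H j lt_j.
  apply: (IH a1 _ k a1G a2'); first by have := excess_lt lt_j lt_k; lia.
  apply/mnmP => x; rewrite !mnmDE mnmBE !mnm1E; have := aEx x.
  by case: (eqVneq j x) lt_j => [->|_] /=; lia.
Qed.

Lemma exchange_gpow G k : exchange G -> exchange (gpow G k).
Proof.
move=> exG; elim: k => [|k IH]; last exact: exchange_msum.
by move=> u v; rewrite !inE => /eqP-> /eqP-> i; rewrite ltnn.
Qed.

Lemma gpow_mdeg G k d :
  (forall u, u \in G -> mdeg u = d) ->
  forall u, u \in gpow G k -> mdeg u = (k * d)%N.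
Proof.
move=> degG; elim: k => [|k IH] u; first by rewrite inE => /eqP->; rewrite mdeg0.
case/allpairsP=> [[a b] /= [/degG aE /IH bE ->]].
by rewrite mdegD aE bE mulSn.
Qed.

Lemma gpow_muln G g k : g \in G -> (g *+ k)%MM \in gpow G k.
Proof.
move=> gG; elim: k => [|k IH]; first by rewrite mulm0n inE.
by rewrite mulmS; apply: allpairs_f.
Qed.

Lemma gpowD G g k l m : g \in G -> m \in gpow G l -> (g *+ k + m)%MM \in gpow G (k + l).
Proof.
move=> gG mG; elim: k => [|k IH]; first by rewrite mulm0n add0m.
by rewrite mulmS -addmA; apply: allpairs_f.
Qed.

End Exchange.

Lemma polymatroidal_pow_regularity (K : fieldType) n (L : {mpoly K[n]} -> Prop) G d k :
  exchange G -> G <> [::] -> (forall u, u \in G -> mdeg u = d) ->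
  same_ideal L (monomial_gen (gpow G k)) ->
  has_regularity L (k * d) /\ has_linear_quotients L.
Proof.
move=> exG G0 degG LG; have degGk := gpow_mdeg (k := k) degG.
apply: (deglex_lq_regularity _ _ LG).
- by move=> u v /degGk uE /degGk vE uv; apply: lem_mdeg uv _; rewrite uE vE.
- exact: exchange_deglex_lq degGk (exchange_gpow (k := k) exG).
- by move=> u /degGk->.
- case: G G0 degG degGk {exG LG} => // g G _ degG degGk.
  have gk : (g *+ k)%MM \in gpow (g :: G) k by apply: gpow_muln; rewrite mem_head.
  by exists (g *+ k)%MM; last apply: degGk.
Qed.

(** * Associated primes and symbolic powers *)

Section Localization.
Local Open Scope ring_scope.
Variables (R : idomainType) (I : R -> Prop).

Lemma symbolic_powP k f :
  symbolic_pow I k f <->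
  forall P, associated_prime I P -> exists2 b, ~ P b & ideal_pow I k (b * f).
Proof.
split=> H P assP; have := H P assP; have [[[P0 _ _] _ _] _] := assP.
  case=> a [b [Ia Pb E]]; exists b => //.
  have b0 : b != 0 by apply/eqP => b0; apply: Pb; rewrite b0.
  suff -> : b * f = a by [].
  apply/eqP; rewrite -tofrac_eq tofracM E mulrC divfK //.
  by rewrite tofrac_eq0.
case=> b Pb If; exists (b * f), b; split=> //.
have b0 : b != 0 by apply/eqP => b0; apply: Pb; rewrite b0.
by rewrite tofracM mulrC mulKf // tofrac_eq0.
Qed.

Lemma prime_ideal_exp (P : R -> Prop) x k : prime_ideal P -> ~ P x -> ~ P (x ^+ k).
Proof.
move=> [_ P1 PM] Px; elim: k => [|k IH]; first by rewrite expr0.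
by rewrite exprS => /PM[].
Qed.

Lemma pow_sub_symbolic k f : ideal_pow I k f -> symbolic_pow I k f.
Proof.
move=> If; apply/symbolic_powP => P [[_ P1 _] _].
by exists 1; rewrite ?mul1r.
Qed.

End Localization.

(** * Cancelling elements outside a monomial prime *)

Section LowestTerms.
Local Open Scope ring_scope.
Variables (K : fieldType) (n : nat).
Implicit Types (V : {set 'I_n}) (m w : 'X_{1..n}) (G : seq 'X_{1..n}).

Lemma mcoeffM_unique (p q : {mpoly K[n]}) a b :
  (forall m1 m2, m1 \in msupp p -> m2 \in msupp q ->
     (m1 + m2)%MM = (a + b)%MM -> m1 = a /\ m2 = b) ->
  (p * q)@_(a + b) = p@_a * q@_b.
Proof.
move=> H; rewrite mcoeffM.
have lt_a : (mdeg a < (mdeg (a + b)%MM).+1)%N by rewrite ltnS mdegD leq_addr.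
have lt_b : (mdeg b < (mdeg (a + b)%MM).+1)%N by rewrite ltnS mdegD leq_addl.
rewrite (bigD1 (BMultinom lt_a, BMultinom lt_b)) //= big1 ?addr0 //.
move=> [m1 m2] /= /andP[/eqP E ne].
apply/eqP; apply: contraNT ne; rewrite mulf_eq0 negb_or => /andP[m1p m2q].
have [||E1 E2] := H m1 m2 _ _ (esym E); rewrite ?mcoeff_msupp //.
by rewrite xpair_eqE -!val_eqE /= E1 E2 !eqxx.
Qed.

Definition vdeg V m := (\sum_(i in V) m i)%N.

Lemma vdegD V m1 m2 : vdeg V (m1 + m2)%MM = (vdeg V m1 + vdeg V m2)%N.
Proof. by rewrite -big_split; apply: eq_bigr => i _; rewrite mnmDE. Qed.

(* A total order compatible with products for which the lowest term of an element
   outside the prime (V) is free of V. *)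
Definition vle V m1 m2 :=
  (vdeg V m1 < vdeg V m2)%N || (vdeg V m1 == vdeg V m2) && (m2 <= m1)%O.

Lemma vle_min V (s : seq 'X_{1..n}) m :
  m \in s -> exists2 x, x \in s & forall y, y \in s -> vle V x y.
Proof.
elim: s m => // a [|b s] IH m _.
  exists a; rewrite ?mem_head // => y; rewrite inE => /eqP->.
  by rewrite /vle eqxx lexx orbT.
have [x xs xmin] := IH b (mem_head _ _).
have [ax|] := boolP (vle V a x).
  exists a => [|y]; first exact: mem_head.
  rewrite inE => /orP[/eqP->|/xmin].
    by rewrite /vle eqxx lexx orbT.
  move: ax; rewrite /vle => /orP[?|/andP[/eqP-> le1]] /orP[?|/andP[/eqP <- le2]];
    do ?[by apply/orP; left; lia].
  by rewrite eqxx (le_trans le2 le1) orbT.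
rewrite /vle negb_or negb_and -leqNgt -ltNge => Nax.
exists x => [|y]; first by rewrite inE xs orbT.
rewrite inE => /orP[/eqP->|/xmin//]; move: Nax => /andP[le_xa].
case: eqP => [->|ne _] /=; first by move=> /ltW->; rewrite eqxx orbT.
by rewrite (_ : (_ < _)%N) //; lia.
Qed.

Lemma vle_addE V m1 m2 a b :
  vle V a m1 -> vle V b m2 -> (m1 + m2)%MM = (a + b)%MM -> m1 = a /\ m2 = b.
Proof.
move=> am1 bm2 E; have := congr1 (vdeg V) E; rewrite !vdegD => Ed.
have le_d x y : vle V x y -> (vdeg V x <= vdeg V y)%N.
  by rewrite /vle => /orP[/ltnW|/andP[/eqP->]].
have le_o x y : vle V x y -> vdeg V x = vdeg V y -> (y <= x)%O.
  by rewrite /vle => /orP[lt_xy E'|/andP[]//]; rewrite E' ltnn in lt_xy.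
have [{}am1 {}bm2] : (m1 <= a)%O /\ (m2 <= b)%O.
  by split; apply: le_o => //; move: (le_d _ _ am1) (le_d _ _ bm2); lia.
move: am1; rewrite le_eqVlt => /orP[/eqP Ea|lt_a].
  by split=> //; apply: (@addmI _ a); rewrite -E Ea.
by have := ltmc_le_add lt_a bm2; rewrite E ltxx.
Qed.

(** Let m0 be the lowest term of b, free of V, and w the lowest among the terms of f outside the
    ideal. Nothing cancels m0 + w in b f, so it lies in the ideal; since the generators involve only
    V, so does w, a contradiction. *)
Lemma monomial_gen_nzd V G (b f : {mpoly K[n]}) :
  (forall g, g \in G -> forall i, i \notin V -> g i = 0%N) ->
  ~ variable_gen V b -> monomial_gen G (b * f) -> monomial_gen G f.
Proof.
move=> GV Vb /monomial_genP Gbf; apply/monomial_genP => w0 w0f.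
apply: contraT => Gw0.
have /hasP[m0' m0'b m0'V] : has (fun m => vdeg V m == 0%N) (msupp b).
  apply: contraT => /hasPn H; exfalso; apply: Vb; apply/variable_genP => m /H.
  rewrite sum_nat_eq0 negb_forall => /existsP[i].
  by rewrite negb_imply -lt0n => /andP[iV mi]; exists i.
have [m0 m0b m0min] := vle_min V m0'b.
have m0V : vdeg V m0 = 0%N.
  by have := m0min _ m0'b; rewrite /vle (eqP m0'V) ltn0 /= => /andP[/eqP].
have [|w + wmin] := @vle_min V [seq w <- msupp f | ~~ mono_in G w] w0.
  by rewrite mem_filter Gw0.
rewrite mem_filter => /andP[Gw wf].
have Gm0 m : mono_in G (m0 + m)%MM -> mono_in G m.
  move=> /mono_inP[g gG /mnm_lepP le]; apply/mono_inP; exists g => //.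
  apply/mnm_lepP => i; have [iV|/(GV _ gG)->//] := boolP (i \in V).
  have := le i; rewrite mnmDE.
  by move/eqP: m0V; rewrite sum_nat_eq0 => /forallP/(_ i); rewrite iV => /eqP->.
suff : (m0 + w)%MM \in msupp (b * f) by move/Gbf/Gm0; rewrite (negPf Gw).
rewrite mcoeff_msupp mcoeffM_unique.
  by rewrite mulf_neq0 // -mcoeff_msupp.
move=> m1 m2 m1b m2f E; apply: (vle_addE (m0min _ m1b) _ E).
apply: wmin; rewrite mem_filter m2f andbT; apply: contra Gw => Gm2.
by apply: Gm0; rewrite -E; apply: mono_in_le Gm2; rewrite lem_addl.
Qed.

(** The case of [monomial_gen_nzd] in which G consists of the variables in V. *)
Lemma variable_gen_prime V : prime_ideal (@variable_gen K n V).
Proof.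
split; first exact: ideal_gen_ideal.
  move=> /variable_genP/(_ 0%MM); rewrite msupp1 mem_head => /(_ isT)[i _].
  by rewrite mnm0E.
move=> f g; have [|Vf] := classic (variable_gen V f); first by left.
rewrite (variable_gen_monomial V (f * g)) (variable_gen_monomial V g) => Vfg.
right; apply: monomial_gen_nzd Vf Vfg => _ /mapP[j + ->] i iV.
by rewrite mem_enum mnm1E; case: eqP => // -> jV; rewrite jV in iV.
Qed.

End LowestTerms.

(** * Bounds on symbolic powers from associated primes *)

Section Symbolic.
Local Open Scope ring_scope.
Variables (K : fieldType) (n : nat) (I : {mpoly K[n]} -> Prop) (G : seq 'X_{1..n}).
Hypothesis IG : same_ideal I (monomial_gen G).

(** The conditions on w say that (V) is the annihilator of the class of x^w. *)
Lemma associated_prime_witness (V : {set 'I_n}) w :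
  (forall i, i \in V -> mono_in G (U_(i) + w)) ->
  (forall g, g \in G -> exists2 i, i \in V & (w i < g i)%N) ->
  associated_prime I (variable_gen V).
Proof.
move=> Vw Gw; split; first exact: variable_gen_prime.
exists 'X_[w] => f; rewrite IG monomial_genP variable_genP; split.
  move=> Vf _ /msuppM_le /allpairsP[[m1 m2] /= [/Vf[i iV mi] + ->]].
  rewrite msuppX inE => /eqP->; apply: mono_in_le (Vw i iV).
  apply/mnm_lepP => x; rewrite !mnmDE mnm1E; case: eqP => [<-|_]; lia.
move=> Gf m mf.
have /Gf/mono_inP[g gG /mnm_lepP le] : (w + m)%MM \in msupp (f * 'X_[w]).
  by rewrite mcoeff_msupp mcoeffMX -mcoeff_msupp.
have [i iV wi] := Gw g gG; exists i => //.
by have := le i; rewrite mnmDE; lia.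
Qed.

(** Localizing at (V) amounts to setting the other variables to 1. The restricted generators involve
    only V, so [monomial_gen_nzd] cancels the multiplier b. *)
Lemma symbolic_pow_restrict (V : {set 'I_n}) k f :
  associated_prime I (variable_gen V) -> symbolic_pow I k f ->
  forall m, m \in msupp f ->
  exists2 g, g \in gpow G k & forall i, i \in V -> (g i <= m i)%N.
Proof.
move=> assV /symbolic_powP/(_ _ assV)[b Vb].
pose restr (g : 'X_{1..n}) := [multinom (if i \in V then g i else 0%N) | i < n].
rewrite (ideal_pow_monomial k IG _) => Ibf.
have : monomial_gen (map restr (gpow G k)) (b * f).
  apply/monomial_genP => m; move/monomial_genP: Ibf => /[apply] /mono_inP[g gG gm].
  apply/mono_inP; exists (restr g); first exact: map_f.
  apply/mnm_lepP => i; rewrite mnmE; case: ifP => // _.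
  exact: (mnm_lepP gm).
move=> /(monomial_gen_nzd _ Vb)/monomial_genP H m mf.
have [_ /mapP[g _ ->] i iV|_ /mapP[g gG ->] /mnm_lepP le] := mono_inP _ _ (H _ m mf).
  by rewrite mnmE (negPf iV).
by exists g => // i iV; have := le i; rewrite mnmE iV.
Qed.

(** If g0_t > 0, the prime (x_t) is associated, with witness g0 / x_t. *)
Lemma symbolic_pow_var t g0 k f :
  g0 \in G -> (forall g, g \in G -> (g0 t <= g t)%N) -> symbolic_pow I k f ->
  forall m, m \in msupp f -> (g0 t * k <= m t)%N.
Proof.
move=> g0G g0min If m mf; have [->//|g0t] := posnP (g0 t).
have assV : associated_prime I (variable_gen [set t]).
  apply: (@associated_prime_witness _ (g0 - U_(t))%MM) => [i|g gG].
    rewrite inE => /eqP->; apply/mono_inP; exists g0 => //.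
    by rewrite addmC submK ?lepm_refl // lep1mP -lt0n.
  exists t; rewrite ?inE // mnmBE mnm1E eqxx.
  by have := g0min g gG; lia.
have [h hG /(_ t)] := symbolic_pow_restrict assV If mf.
rewrite inE eqxx => /(_ isT); apply: leq_trans.
elim: k {If} h hG => [|k IH] h; first by rewrite muln0.
case/allpairsP=> [[a b] /= [/g0min aE /IH bE ->]].
by rewrite mulnS mnmDE leq_add.
Qed.

Lemma gpow_nonempty k : G <> [::] -> exists g, g \in gpow G k.
Proof. by case: G => // g G' _; exists (g *+ k)%MM; apply: gpow_muln; rewrite mem_head. Qed.

(** The prime (V) bounds the exponents in V from below; outside V all generators agree, and
    [symbolic_pow_var] gives the remaining bounds. *)
Lemma symbolic_pow_full (V : {set 'I_n}) d w k f :
  G <> [::] -> (forall g, g \in G -> mdeg g = d) ->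
  (forall g h i, g \in G -> h \in G -> i \notin V -> g i = h i) ->
  (forall i, i \in V -> (U_(i) + w)%MM \in G) ->
  symbolic_pow I k f <-> ideal_pow I k f.
Proof.
move=> G0 degG GV wG; split; last exact: pow_sub_symbolic.
move=> If; apply/(ideal_pow_monomial k IG)/monomial_genP => m mf.
have [h hG hm] : exists2 h, h \in gpow G k & forall i, i \in V -> (h i <= m i)%N.
  have [V0|[i iV]] := set_0Vmem V.
    by have [h hG] := gpow_nonempty k G0; exists h => // i; rewrite V0 inE.
  apply: (symbolic_pow_restrict _ If mf).
  apply: (@associated_prime_witness _ w) => [j /wG jG|g gG].
    by apply/mono_inP; exists (U_(j) + w)%MM => //; apply: lepm_refl.
  apply/exists_inP; apply: contraT => /exists_inPn H.
  have le_gw : (g <= w)%MM.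
    apply/mnm_lepP => j; have [jV|jV] := boolP (j \in V).
      by rewrite leqNgt H.
    rewrite (GV g _ j gG (wG i iV) jV) mnmDE mnm1E.
    by case: eqP => // E; rewrite -E iV in jV.
  (* A generator dividing w would have degree at most d - 1. *)
  have := degG _ (wG i iV); rewrite mdegD mdeg1 -(degG g gG) -(submK le_gw) mdegD.
  lia.
apply/mono_inP; exists h => //; apply/mnm_lepP => i.
have [/hm//|iV] := boolP (i \in V).
have [g0 g0G] : exists g, g \in G.
  by case: (G) G0 => // g0 G' _; exists g0; apply: mem_head.
have -> : h i = (g0 i * k)%N.
  elim: k h hG {If mf hm} => [|k IH] h.
    by rewrite inE => /eqP->; rewrite muln0 mnm0E.
  case/allpairsP=> [[a b] /= [aG /IH bE ->]].
  by rewrite mulnS mnmDE bE (GV a g0 i aG g0G iV).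
by apply: (symbolic_pow_var g0G _ If mf) => g gG; rewrite (GV g0 g i).
Qed.

End Symbolic.

(** * Three active variables *)

Section Triangles.
Variables (n : nat) (G : seq 'X_{1..n}) (d : nat).
Hypotheses (exG : exchange G) (degG : forall g, g \in G -> mdeg g = d).
Implicit Types (u v w g q : 'X_{1..n}).

Lemma mnm_pos u i : (0 < u i)%N -> u = (U_(i) + (u - U_(i)))%MM.
Proof. by move=> ui; rewrite addmC submK // lep1mP -lt0n. Qed.

Lemma exchange_fwd u v i : u \in G -> v \in G -> (v i < u i)%N ->
  exists q j, [/\ u = (U_(i) + q)%MM, (u j < v j)%N & (U_(j) + q)%MM \in G].
Proof.
move=> uG vG vui; have [j uvj jG] := exG uG vG vui.
by exists (u - U_(i))%MM, j; split=> //; apply: mnm_pos; lia.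
Qed.

(** Here the entering index j is prescribed instead of the leaving one. Exchanges move v towards u
    while keeping v_j > u_j, until v exceeds u only at j and only by one; then v is itself x_j u /
    x_k for some k. *)
Lemma exchange_bwd u v j : u \in G -> v \in G -> (u j < v j)%N ->
  exists q i, [/\ u = (U_(i) + q)%MM, (v i < u i)%N & (U_(j) + q)%MM \in G].
Proof.
move=> uG; move: {2}(excess v u).+1 (leqnn (excess v u).+1) => N.
elim: N v => // N IH v leN vG uvj.
have [m /andP[umv mj]|Nm] :=
  pickP (fun m => (u m < v m)%N && ((m != j) || ((u j).+1 < v j)%N)).
  have [k vuk v'G] := exG vG uG umv.
  have [||q [i [uE v'ui jq]]] := IH _ _ v'G.
  - by have := excess_lt umv vuk; lia.
  - rewrite mnmDE mnmBE !mnm1E.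
    by case: (eqVneq m j) mj umv => [->|_ _ _]; case: (_ == _) => /=; lia.
  exists q, i; split=> //; move: v'ui; rewrite mnmDE mnmBE !mnm1E.
  by move: umv vuk; case: (eqVneq m i) => [->|_]; case: (eqVneq k i) => [->|_] /=; lia.
have vj : v j = (u j).+1 by have := Nm j; rewrite eqxx uvj /=; lia.
have le_vu x : x != j -> (v x <= u x)%N by move=> xj; have := Nm x; rewrite xj andbT; lia.
have [q [k [vE vuk kq]]] := exchange_fwd vG uG uvj.
have uE : (U_(k) + q)%MM = u.
  apply: lem_mdeg; last by rewrite !degG.
  apply/mnm_lepP => x; move/mnmP/(_ x): vE; have := le_vu x.
  rewrite !mnmDE !mnm1E (eq_sym x); case: (eqVneq j x) => [<-|_] /=.
    by case: (eqVneq k j) vuk => [->|_] /=; lia.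
  by case: (eqVneq k x) vuk => [<-|_] /=; lia.
by exists q, k; split=> //; rewrite -vE.
Qed.

Section Plane.
Variables (a b c : 'I_n).
Hypotheses (ab : a != b) (ac : a != c) (bc : b != c).
Hypothesis off : forall g h x, g \in G -> h \in G ->
  x != a -> x != b -> x != c -> g x = h x.

Let ne := (negPf ab, negPf ac, negPf bc,
  etrans (eq_sym b a) (negPf ab), etrans (eq_sym c a) (negPf ac),
  etrans (eq_sym c b) (negPf bc)).

Lemma off_edge g h x : g \in G -> h \in G -> g x != h x -> [\/ x = a, x = b | x = c].
Proof.
move=> gG hG; case: (eqVneq x a) => [->|xa]; first by constructor 1.
case: (eqVneq x b) => [->|xb]; first by constructor 2.
case: (eqVneq x c) => [->|xc]; first by constructor 3.
by rewrite (off gG hG) ?eqxx.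
Qed.

(** If g_c > w_c, bring c into both ends of the edge by [exchange_bwd]. Removing a from x_a w, or b
    from x_b w, would give x_c w; so b leaves x_a w and a leaves x_b w, and an exchange between the
    two results gives x_c w again. *)
Lemma edge_upper_bound w g :
  (U_(a) + w)%MM \in G -> (U_(b) + w)%MM \in G -> (U_(c) + w)%MM \notin G ->
  g \in G -> (g c <= w c)%N.
Proof.
move=> aG bG cG gG; rewrite leqNgt; apply/negP => wgc.
have [|q [i [aE gi cq]]] := @exchange_bwd _ g c aG gG; first by rewrite mnmDE mnm1E ne.
have [|q' [i' [bE gi' cq']]] := @exchange_bwd _ g c bG gG; first by rewrite mnmDE mnm1E ne.
have : i = b.
  have [Ei|//|Ei] := off_edge gG aG (negbT (ltn_eqF gi)); subst i.
    by case/negP: cG; rewrite (addmI aE).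
  by move: gi wgc; rewrite mnmDE mnm1E ne; clear; lia.
have : i' = a.
  have [//|Ei|Ei] := off_edge gG bG (negbT (ltn_eqF gi')); subst i'.
    by case/negP: cG; rewrite (addmI bE).
  by move: gi' wgc; rewrite mnmDE mnm1E ne; clear; lia.
move=> Ei' Ei; subst i i'.
have wb : (0 < (w - U_(a))%MM b)%N.
  by have /mnmP/(_ b) := aE; rewrite !mnmDE mnmBE !mnm1E eqxx ne; clear; lia.
have wa : (0 < w a)%N.
  by have /mnmP/(_ a) := bE; rewrite !mnmDE !mnm1E eqxx ne; clear; lia.
have wE := mnm_pos wa; rewrite [(w - U_(a))%MM](mnm_pos wb) in wE.
set s := (_ - _ - _)%MM in wE.
have qE : q = (U_(a) + (U_(a) + s))%MM.
  by apply/mnmP => x; have /mnmP/(_ x) := aE; rewrite wE !mnmDE; clear; lia.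
have q'E : q' = (U_(b) + (U_(b) + s))%MM.
  by apply/mnmP => x; have /mnmP/(_ x) := bE; rewrite wE !mnmDE; clear; lia.
have [|r [j [rE lt_j jr]]] := @exchange_fwd _ _ a cq cq'.
  by rewrite qE q'E !mnmDE !mnm1E ?eqxx ?ne; clear; lia.
have Ej : j = b.
  have [Ej|//|Ej] := off_edge cq cq' (negbT (ltn_eqF lt_j)); subst j;
    by move: lt_j; rewrite qE q'E !mnmDE !mnm1E ?eqxx ?ne; clear; lia.
case/negP: cG; suff -> : (U_(c) + w)%MM = (U_(j) + r)%MM by [].
by apply/mnmP => x; have /mnmP/(_ x) := rE; rewrite wE qE Ej !mnmDE; clear; lia.
Qed.

(** Replace c in both ends of the edge. Either x_a x_b p appears at once, or both x_a^2 p and x_b^2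
    p do, and exchanging between them produces it. *)
Lemma edge_down_triangle w g :
  (U_(a) + w)%MM \in G -> (U_(b) + w)%MM \in G -> g \in G -> (g c < w c)%N ->
  exists2 p, w = (U_(c) + p)%MM & (U_(a) + (U_(b) + p))%MM \in G.
Proof.
move=> aG bG gG gw; have wc : (0 < w c)%N := leq_ltn_trans (leq0n _) gw.
exists (w - U_(c))%MM; first exact: mnm_pos.
have := mnm_pos wc; set p := (w - _)%MM => wE.
have [|q [i [aE gi iq]]] := @exchange_fwd _ g c aG gG; first by rewrite mnmDE mnm1E ne.
have [|q' [i' [bE gi' iq']]] := @exchange_fwd _ g c bG gG; first by rewrite mnmDE mnm1E ne.
have qE : q = (U_(a) + p)%MM.
  by apply/mnmP => x; have /mnmP/(_ x) := aE; rewrite wE !mnmDE; clear; lia.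
have q'E : q' = (U_(b) + p)%MM.
  by apply/mnmP => x; have /mnmP/(_ x) := bE; rewrite wE !mnmDE; clear; lia.
have [Ei|Ei|Ei] := off_edge aG gG (negbT (ltn_eqF gi)); subst i; last first.
- by move: gi gw; rewrite mnmDE mnm1E ne; clear; lia.
- by rewrite addmA [(U_(a) + _)%MM]addmC -addmA -qE.
have [Ei|Ei|Ei] := off_edge bG gG (negbT (ltn_eqF gi')); subst i'; last first.
- by move: gi' gw; rewrite mnmDE mnm1E ne; clear; lia.
- rewrite q'E in iq'; rewrite qE in iq.
  have [|r [j [rE lt_j jr]]] := @exchange_fwd _ _ a iq iq'.
    by rewrite !mnmDE !mnm1E ?eqxx ?ne; clear; lia.
  have Ej : j = b.
    have [Ej|//|Ej] := off_edge iq iq' (negbT (ltn_eqF lt_j)); subst j;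
      by move: lt_j; rewrite !mnmDE !mnm1E ?eqxx ?ne; clear; lia.
  suff -> : (U_(a) + (U_(b) + p))%MM = (U_(j) + r)%MM by [].
  by apply/mnmP => x; have /mnmP/(_ x) := rE; rewrite Ej !mnmDE; clear; lia.
- by rewrite -q'E.
Qed.

End Plane.

Definition active : {set 'I_n} :=
  [set i | has (fun u => has (fun v => (v i < u i)%N) G) G].

Lemma inactive_const g h i : g \in G -> h \in G -> i \notin active -> g i = h i.
Proof.
move=> gG hG; case: (ltngtP (g i) (h i)) => // lt_i /negP[]; rewrite inE.
  by apply/hasP; exists h => //; apply/hasP; exists g.
by apply/hasP; exists g => //; apply/hasP; exists h.
Qed.

(* In the plane spanned by three active variables, a set without an upward triangle
   w + e_a, w + e_b, w + e_c lies on one side of each of its edges, and on the other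
   side the exchange property completes an edge to a downward triangle; the bounds
   from the three edges of that triangle exclude all other points. *)
Lemma active_trichotomy : (#|active| <= 3)%N ->
  [\/ active = set0, exists w, forall i, i \in active -> (U_(i) + w)%MM \in G |
   exists a b c p, [/\ uniq [:: a; b; c],
     G =i [:: U_(b) + (U_(c) + p); U_(a) + (U_(c) + p); U_(a) + (U_(b) + p)]%MM
     & active = [set a; b; c]]].
Proof.
move=> le3; have [->|[a aA]] := set_0Vmem active; first by constructor 1.
have [[w wG]|NU] := classic (exists w, forall i, i \in active -> (U_(i) + w)%MM \in G).
  by constructor 2; exists w.
constructor 3.
have /hasP[u uG /hasP[v vG vua]] : has (fun u => has (fun v => (v a < u a)%N) G) G.
  by rewrite inE in aA.
have [w [b [uE uvb bG]]] := exchange_fwd uG vG vua.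
have aG : (U_(a) + w)%MM \in G by rewrite -uE.
have ab : a != b by apply: contraTneq uvb => <-; rewrite -leqNgt ltnW.
have bA : b \in active.
  by rewrite inE; apply/hasP; exists v => //; apply/hasP; exists u.
have [c cA /andP[ca cb]] : exists2 c, c \in active & (c != a) && (c != b).
  apply/exists_inP; apply: contra_notT NU => /exists_inPn H.
  exists w => i /H; rewrite negb_and !negbK => /orP[]/eqP-> //.
have activeE : active = [set a; b; c].
  apply/esym/eqP; rewrite eqEcard !subUset !sub1set aA bA cA /=.
  apply: leq_trans le3 _; rewrite setUC cardsU1 cards2 ab !inE.
  by rewrite negb_or ca cb.
have off g h x : g \in G -> h \in G -> x != a -> x != b -> x != c -> g x = h x.
  by move=> gG hG xa xb xc; apply: inactive_const => //; rewrite activeE !inE !negb_or xa xb xc.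
rewrite eq_sym in ca; rewrite eq_sym in cb.
have up3 w' : (U_(a) + w')%MM \in G -> (U_(b) + w')%MM \in G -> (U_(c) + w')%MM \in G -> False.
  move=> aw bw cw; apply: NU; exists w' => i.
  by rewrite activeE !inE => /orP[/orP[]|] /eqP->.
(* All of G satisfies g_c <= w_c, and the exponent of c varies on G. *)
have [g gG gwc] : exists2 g, g \in G & (g c < w c)%N.
  have le_wc := edge_upper_bound ab ca cb off aG bG (introN idP (up3 w aG bG)).
  move: cA; rewrite inE => /hasP[g gG /hasP[h hG hgc]].
  by exists h => //; apply: leq_trans hgc (le_wc g gG).
have [p wE cG] := edge_down_triangle ab ca cb off aG bG gG gwc.
rewrite {}wE in aG bG.
have AC x y : (U_(x) + (U_(y) + p) = U_(y) + (U_(x) + p))%MM.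
  by rewrite !addmA [(U_(x) + _)%MM]addmC.
have Up x : (U_(x) + p)%MM x = (p x).+1 by rewrite mnmDE mnm1E eqxx.
(* Each edge of the downward triangle is also an edge of an upward one, whose third vertex is
   missing by [up3]. *)
have le_t h : h \in G -> [/\ (h a <= (p a).+1)%N, (h b <= (p b).+1)%N & (h c <= (p c).+1)%N].
  have cG' : (U_(b) + (U_(a) + p))%MM \in G by rewrite AC.
  have aG' : (U_(c) + (U_(a) + p))%MM \in G by rewrite AC.
  have bG' : (U_(c) + (U_(b) + p))%MM \in G by rewrite AC.
  move=> hG; rewrite -!Up; split.
  - apply: (edge_upper_bound cb _ _ _ cG' aG' _ hG) => //; rewrite 1?eq_sym //.
      by move=> g1 g2 t g1G g2G *; apply: off.
    by apply/negP => aaG; apply: (up3 _ aaG cG' aG').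
  - apply: (edge_upper_bound ca _ _ _ cG bG' _ hG) => //; rewrite 1?eq_sym //.
      by move=> g1 g2 t g1G g2G *; apply: off.
    by apply/negP => bbG; apply: (up3 _ cG bbG bG').
  - apply: (edge_upper_bound ab _ _ _ aG bG _ hG) => //.
    by apply/negP; apply: up3.
exists a, b, c, p; split=> //; first by rewrite /= !inE negb_or ab ca cb.
move=> h; rewrite !inE; apply/idP/or3P; last by case=> /eqP->.
move=> hG.
(* This monomial has degree d + 1 and is divisible by every h in G by the three bounds, so h is t
   divided by one variable, which must be active. *)
pose t := (U_(a) + (U_(b) + (U_(c) + p)))%MM.
have tx x : t x = (p x + (x \in active))%N.
  rewrite activeE !inE !mnmDE !mnm1E !(eq_sym x).
  case: (eqVneq a x) ab ca => [<-|_ _ _].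
    by rewrite ![_ == a]eq_sym => /negPf-> /negPf->; clear; lia.
  by case: (eqVneq b x) cb => [<-|_ _] /=; first rewrite eq_sym => /negPf->; clear; lia.
have [x htx] : exists x, (h x < t x)%N.
  apply/existsP; apply: contraT; rewrite negb_exists => /forallP le_th.
  have le_th' : (t <= h)%MM by apply/mnm_lepP => x; rewrite leqNgt.
  have := degG hG; rewrite -(submK le_th') mdegD /t.
  by rewrite -(degG cG) !mdegD !mdeg1; clear; lia.
have [le_a le_b le_c] := le_t h hG.
have off_t y : y \notin active -> h y = t y.
  move=> yA; rewrite tx (negPf yA) addn0 (inactive_const hG cG yA) !mnmDE !mnm1E.
  move: yA; rewrite activeE !inE !negb_or ![y == _]eq_sym.
  by case/andP=> /andP[/negPf-> /negPf->].
have le_ht y : (h y <= t y)%N.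
  have [yA|/off_t->//] := boolP (y \in active).
  by rewrite tx yA addn1; move: yA; rewrite activeE !inE => /orP[/orP[]|] /eqP->.
have hE : (U_(x) + h)%MM = t.
  apply: lem_mdeg.
    apply/mnm_lepP => y; rewrite mnmDE mnm1E; case: eqP => [<-//|_].
    exact: le_ht.
  by rewrite /t !mdegD !mdeg1 (degG hG) -(degG cG) !mdegD !mdeg1.
have : x \in active by apply: contraLR htx => /off_t->; rewrite ltnn.
rewrite activeE !inE => /orP[/orP[]|] /eqP Ex; move: hE; rewrite Ex /t.
- by move/addmI->; constructor 1.
- rewrite addmA [(U_(a) + U_(b))%MM]addmC -addmA.
  by move/addmI->; constructor 2.
- rewrite [(U_(b) + _)%MM]addmA [(U_(b) + U_(c))%MM]addmC -addmA.
  rewrite addmA [(U_(a) + U_(c))%MM]addmC -addmA.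
  by move/addmI->; constructor 3.
Qed.

End Triangles.

(** * Symbolic powers of the triangle ideal *)

Section Triangle.
Variables (K : fieldType) (n : nat) (I : {mpoly K[n]} -> Prop) (G : seq 'X_{1..n}).
Variables (a b c : 'I_n) (p : 'X_{1..n}) (k : nat).
Hypothesis abc : uniq [:: a; b; c].
Hypothesis IG : same_ideal I (monomial_gen G).
Hypothesis GE :
  G =i [:: U_(b) + (U_(c) + p); U_(a) + (U_(c) + p); U_(a) + (U_(b) + p)]%MM.

Let ne : ((a == b) = false) * ((a == c) = false) * ((b == c) = false) *
  ((b == a) = false) * ((c == a) = false) * ((c == b) = false).
Proof.
move: abc; rewrite /= !inE negb_or andbT => /andP[/andP[/negPf ab /negPf ac] /negPf bc].
by rewrite ![_ == a]eq_sym [c == b]eq_sym ab ac bc.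
Qed.

(** Exponents are counted beyond those of p^k, since p may itself involve a, b, c. *)
Definition tri x y z : 'X_{1..n} :=
  (U_(a) *+ x + (U_(b) *+ y + (U_(c) *+ z + p *+ k)))%MM.

Lemma triE x y z : [/\ tri x y z a = (x + p a * k)%N,
  tri x y z b = (y + p b * k)%N & tri x y z c = (z + p c * k)%N].
Proof. by rewrite /tri !mnmDE !mulmnE !mnm1E !eqxx !ne; split; lia. Qed.

Lemma mdeg_tri x y z : mdeg (tri x y z) = (x + y + z + mdeg p * k)%N.
Proof. by rewrite /tri !mdegD !mdegMn !mdeg1; lia. Qed.

Lemma tri_le x y z m : (p *+ k <= m)%MM -> (x + p a * k <= m a)%N ->
  (y + p b * k <= m b)%N -> (z + p c * k <= m c)%N -> (tri x y z <= m)%MM.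
Proof.
move=> /mnm_lepP pm ax bx cx; apply/mnm_lepP => t; have := pm t.
rewrite /tri !mnmDE !mulmnE !mnm1E.
case: (eqVneq a t) => [<-|_]; first by rewrite !ne; lia.
case: (eqVneq b t) => [<-|_]; first by rewrite !ne; lia.
by case: (eqVneq c t) => [<-|_]; lia.
Qed.

Lemma tri_le_tri x y z x' y' z' : (tri x y z <= tri x' y' z')%MM ->
  [/\ x <= x', y <= y' & z <= z']%N.
Proof.
move=> /mnm_lepP le; move: (le a) (le b) (le c).
have [-> -> ->] := triE x y z; have [-> -> ->] := triE x' y' z'.
by rewrite !leq_add2r.
Qed.

Lemma tri_le_U t x y z x' y' z' : (x' <= (t == a) + x -> y' <= (t == b) + y ->
  z' <= (t == c) + z -> (tri x' y' z' <= U_(t) + tri x y z)%MM)%N.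
Proof.
have [Ea Eb Ec] := triE x y z => xx yy zz.
apply: tri_le; first by rewrite /tri !addmA lem_addl.
all: by rewrite mnmDE mnm1E ?Ea ?Eb ?Ec addnA leq_add2r.
Qed.

(* For p = 0 these are the minimal exponents (x, y, z) with all pairwise sums at
   least k, the symbolic power being the intersection of the k-th powers of
   (a, b), (a, c) and (b, c).  For k even the exponent (k/2, k/2, k/2) is listed
   three times. *)
Definition tri_gens := [seq tri j (k - j) (k - j) | j <- iota 0 k./2.+1]
  ++ [seq tri (k - j) j (k - j) | j <- iota 0 k./2.+1]
  ++ [seq tri (k - j) (k - j) j | j <- iota 0 k./2.+1].

Lemma tri_gensP u : reflect (exists x y z, u = tri x y z /\
    exists2 j, (j.*2 <= k)%N & [\/ [/\ x = j, y = k - j & z = k - j],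
      [/\ x = k - j, y = j & z = k - j] | [/\ x = k - j, y = k - j & z = j]]%N)
  (u \in tri_gens).
Proof.
rewrite !mem_cat; apply: (iffP or3P).
  case=> /mapP[j]; rewrite mem_iota => jk ->; do 3 eexists; split; try reflexivity.
  - by exists j; [lia | constructor 1].
  - by exists j; [lia | constructor 2].
  - by exists j; [lia | constructor 3].
case=> x [y [z [-> [j jk H]]]].
have jI : j \in iota 0 k./2.+1 by rewrite mem_iota; lia.
case: H => -[-> -> ->]; [constructor 1|constructor 2|constructor 3]; by apply/mapP; exists j.
Qed.

Lemma tri_gens_antichain : antichain tri_gens.
Proof.
move=> _ _ /tri_gensP[x [y [z [-> [j jk H]]]]] /tri_gensP[x' [y' [z' [-> [j' jk' H']]]]].
move=> /tri_le_tri[xx yy zz]; suff [-> -> ->] : [/\ x = x', y = y' & z = z'] by [].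
by case: H => -[? ? ?]; case: H' => -[? ? ?]; split; lia.
Qed.

(** For u = (j, k - j, k - j) the variable with exponent j serves against every smaller v. If 2 (j +
    1) <= k, the product is divisible by the generator for j + 1, of smaller degree; otherwise u has
    least degree and v itself divides the product. *)
Lemma tri_gens_lq : deglex_lq tri_gens.
Proof.
move=> u v uT vT vu.
have le_deg := lemc_mdeg (ltW vu).
have ne_vu : v != u by rewrite lt_eqF.
have vT' := vT; move: uT vT'.
case/tri_gensP=> x [y [z [uE [j jk H]]]]; case/tri_gensP=> x' [y' [z' [vE [j' jk' H']]]].
have ne3 : ~ (x = x' /\ y = y' /\ z = z').
  by case=> Ex [Ey Ez]; move: ne_vu; rewrite uE vE Ex Ey Ez eqxx.
move: le_deg; rewrite uE vE !mdeg_tri => le_deg.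
have [Ua Ub Uc] := triE x y z; have [Va Vb Vc] := triE x' y' z'.
have up t x1 y1 z1 : (tri x1 y1 z1 \in tri_gens) ->
    (x1 + y1 + z1 < x + y + z)%N ->
    (x1 <= (t == a) + x)%N -> (y1 <= (t == b) + y)%N -> (z1 <= (t == c) + z)%N ->
    exists2 w, w \in tri_gens & ((w < tri x y z)%O && (w <= U_(t) + tri x y z)%MM).
  move=> T1 lt1 lx ly lz; exists (tri x1 y1 z1) => //; apply/andP; split.
    by apply: lt_mdeg_ltmc; rewrite !mdeg_tri; lia.
  exact: tri_le_U.
have dn t : (x' <= (t == a) + x)%N -> (y' <= (t == b) + y)%N -> (z' <= (t == c) + z)%N ->
    exists2 w, w \in tri_gens & ((w < tri x y z)%O && (w <= U_(t) + tri x y z)%MM).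
  by move=> lx ly lz; exists v => //; rewrite -uE vu vE uE tri_le_U.
case: H => -[Ex Ey Ez].
- exists a; first by rewrite Ua Va; case: H' => -[? ? ?]; lia.
  have [lt_j|ge_j] := leqP (j.+1).*2 k.
    apply: (up a j.+1 (k - j.+1) (k - j.+1))%N; rewrite ?eqxx ?ne; try lia.
    apply/tri_gensP; do 3 eexists; split; first by reflexivity.
    by exists j.+1 => //; constructor 1.
  by apply: dn; rewrite ?eqxx ?ne; case: H' => -[? ? ?]; lia.
- exists b; first by rewrite Ub Vb; case: H' => -[? ? ?]; lia.
  have [lt_j|ge_j] := leqP (j.+1).*2 k.
    apply: (up b (k - j.+1) j.+1 (k - j.+1))%N; rewrite ?eqxx ?ne; try lia.
    apply/tri_gensP; do 3 eexists; split; first by reflexivity.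
    by exists j.+1 => //; constructor 2.
  by apply: dn; rewrite ?eqxx ?ne; case: H' => -[? ? ?]; lia.
- exists c; first by rewrite Uc Vc; case: H' => -[? ? ?]; lia.
  have [lt_j|ge_j] := leqP (j.+1).*2 k.
    apply: (up c (k - j.+1) (k - j.+1) j.+1)%N; rewrite ?eqxx ?ne; try lia.
    apply/tri_gensP; do 3 eexists; split; first by reflexivity.
    by exists j.+1 => //; constructor 3.
  by apply: dn; rewrite ?eqxx ?ne; case: H' => -[? ? ?]; lia.
Qed.

Lemma tri_gens_dvd m : (p *+ k <= m)%MM ->
  (k + p a * k + p b * k <= m a + m b)%N -> (k + p a * k + p c * k <= m a + m c)%N ->
  (k + p b * k + p c * k <= m b + m c)%N -> mono_in tri_gens m.
Proof.
move=> pm; move: (mnm_lepP pm a) (mnm_lepP pm b) (mnm_lepP pm c).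
rewrite !mulmnE => pa pb pc hab hac hbc.
set x := (m a - p a * k)%N; set y := (m b - p b * k)%N; set z := (m c - p c * k)%N.
(* The least exponent, capped at [k./2]; when the cap applies, the other two are still at least k -
   j. *)
have jP i : exists2 j, j = minn i k./2 & (j.*2 <= k)%N.
  by exists (minn i k./2) => //; lia.
have [[xy xz]|[[yx yz]|[zx zy]]] :
    (x <= y /\ x <= z \/ (y <= x /\ y <= z \/ z <= x /\ z <= y))%N by lia.
- have [j jE jk] := jP x; apply/mono_inP; exists (tri j (k - j) (k - j)).
    by apply/tri_gensP; do 3 eexists; split; [reflexivity | exists j => //; constructor 1].
  by apply: tri_le => //; rewrite /x /y /z in xy xz jE *; lia.
- have [j jE jk] := jP y; apply/mono_inP; exists (tri (k - j) j (k - j)).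
    by apply/tri_gensP; do 3 eexists; split; [reflexivity | exists j => //; constructor 2].
  by apply: tri_le => //; rewrite /x /y /z in yx yz jE *; lia.
- have [j jE jk] := jP z; apply/mono_inP; exists (tri (k - j) (k - j) j).
    by apply/tri_gensP; do 3 eexists; split; [reflexivity | exists j => //; constructor 3].
  by apply: tri_le => //; rewrite /x /y /z in zx zy jE *; lia.
Qed.

Lemma tri_base t g : g \in G -> (p t <= g t)%N.
Proof. by rewrite GE !inE => /or3P[] /eqP->; rewrite !mnmDE; lia. Qed.

(** The prime (x, y) is associated, with witness x_z p, and each factor from G adds at least one to
    the joint exponent of x and y beyond that of p. *)
Lemma tri_pair x y z f m : x != y -> z != x -> z != y ->
  (U_(x) + (U_(z) + p))%MM \in G -> (U_(y) + (U_(z) + p))%MM \in G ->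
  (forall g, g \in G -> (p x + p y < g x + g y)%N) ->
  symbolic_pow I k f -> m \in msupp f -> (k + p x * k + p y * k <= m x + m y)%N.
Proof.
move=> xy zx zy xG yG Gxy If mf.
have assV : associated_prime I (variable_gen [set x; y]).
  apply: (associated_prime_witness IG (w := (U_(z) + p)%MM)) => [i|g gG].
    rewrite !inE => /orP[] /eqP->; apply/mono_inP.
      by exists (U_(x) + (U_(z) + p))%MM => //; apply: lepm_refl.
    by exists (U_(y) + (U_(z) + p))%MM => //; apply: lepm_refl.
  have := Gxy g gG; have [lt_x _|le_x lt_xy] := ltnP (p x) (g x).
    by exists x; rewrite ?set21 // mnmDE mnm1E (negPf zx).
  by exists y; rewrite ?set22 // mnmDE mnm1E (negPf zy); lia.
have [h hG hm] := symbolic_pow_restrict IG assV If mf.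
have := hm x (set21 x y); have := hm y (set22 x y).
suff : (k + p x * k + p y * k <= h x + h y)%N by lia.
elim: (k) h hG {hm} => [|l IH] h; first by rewrite !muln0.
case/allpairsP=> [[g g'] /= [/Gxy lt_g /IH le_g' ->]].
by rewrite !mulnS !mnmDE; lia.
Qed.

Lemma symbolic_pow_tri f : symbolic_pow I k f -> monomial_gen tri_gens f.
Proof.
move=> If; apply/monomial_genP => m mf.
have Ga : (U_(b) + (U_(c) + p))%MM \in G by rewrite GE mem_head.
have Gb : (U_(a) + (U_(c) + p))%MM \in G by rewrite GE !inE eqxx orbT.
have Gc : (U_(a) + (U_(b) + p))%MM \in G by rewrite GE !inE eqxx !orbT.
have AC x y : (U_(x) + (U_(y) + p) = U_(y) + (U_(x) + p))%MM.
  by rewrite !addmA [(U_(x) + _)%MM]addmC.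
apply: tri_gens_dvd.
- apply/mnm_lepP => t; rewrite mulmnE.
  (* A generator not using t beyond p feeds [symbolic_pow_var]. *)
  have [g0 gG gt] : exists2 g0, g0 \in G & g0 t = p t.
    have [<-|at_] := eqVneq a t.
      by exists (U_(b) + (U_(c) + p))%MM; rewrite // !mnmDE !mnm1E !ne.
    have [<-|bt] := eqVneq b t.
      by exists (U_(a) + (U_(c) + p))%MM; rewrite // !mnmDE !mnm1E !ne.
    by exists (U_(a) + (U_(b) + p))%MM; rewrite // !mnmDE !mnm1E (negPf at_) (negPf bt).
  by rewrite -gt; apply: (symbolic_pow_var IG gG _ If mf) => g; rewrite gt; apply: tri_base.
- apply: (@tri_pair a b c f m) If mf; rewrite ?ne // => g.
  by rewrite GE !inE => /or3P[] /eqP->; rewrite !mnmDE !mnm1E ?eqxx ?ne; lia.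
- apply: (@tri_pair a c b f m) If mf; rewrite ?ne // 1?AC // => g.
  by rewrite GE !inE => /or3P[] /eqP->; rewrite !mnmDE !mnm1E ?eqxx ?ne; lia.
- apply: (@tri_pair b c a f m) If mf; rewrite ?ne // 1?AC // => g.
  by rewrite GE !inE => /or3P[] /eqP->; rewrite !mnmDE !mnm1E ?eqxx ?ne; lia.
Qed.

Lemma tri_mono_in m : mono_in G m <-> (p <= m)%MM /\
  (p b < m b /\ p c < m c \/ p a < m a /\ p c < m c \/ p a < m a /\ p b < m b)%N.
Proof.
have add2 x y : (x == y) = false -> (p <= m)%MM -> (p x < m x)%N -> (p y < m y)%N ->
    (U_(x) + (U_(y) + p) <= m)%MM.
  move=> xy /mnm_lepP pm mx my; apply/mnm_lepP => t; have := pm t.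
  rewrite !mnmDE !mnm1E; case: (eqVneq x t) => [<-|_].
    by rewrite eq_sym xy; lia.
  by case: (eqVneq y t) => [<-|_]; lia.
split.
  case/mono_inP=> g; rewrite GE !inE => gE gm.
  have pm : (p <= m)%MM.
    by case/or3P: gE gm => /eqP->; apply: lepm_trans; rewrite addmA lem_addl.
  split=> //; move: (mnm_lepP gm a) (mnm_lepP gm b) (mnm_lepP gm c).
  by case/or3P: gE => /eqP->; rewrite !mnmDE !mnm1E ?eqxx !ne; lia.
case=> pm H; apply/mono_inP; case: H => [[mb mc]|[[ma mc]|[ma mb]]].
- by exists (U_(b) + (U_(c) + p))%MM; rewrite ?GE ?mem_head // add2 // ne.
- by exists (U_(a) + (U_(c) + p))%MM; rewrite ?GE ?inE ?eqxx ?orbT // add2 // ne.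
- by exists (U_(a) + (U_(b) + p))%MM; rewrite ?GE ?inE ?eqxx ?orbT // add2 // ne.
Qed.

Lemma tri_colon m : mono_in G (U_(a) + m) -> mono_in G (U_(b) + m) ->
  mono_in G (U_(c) + m) -> mono_in G m.
Proof.
move=> /tri_mono_in[/mnm_lepP pa Ha] /tri_mono_in[/mnm_lepP pb Hb] /tri_mono_in[_ Hc].
have pm t : (p t <= m t)%N.
  have := pa t; have := pb t; rewrite !mnmDE !mnm1E.
  by case: (eqVneq a t) => [<-|//]; rewrite ne.
apply/tri_mono_in; split; first exact/mnm_lepP.
move: Ha Hb Hc (pm a) (pm b) (pm c); rewrite !mnmDE !mnm1E !eqxx !ne.
lia.
Qed.

(** If P, the annihilator of h, contained all three variables, [tri_colon] would put every monomial
    of h in I, so 1 would lie in P. *)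
Lemma associated_prime_tri P : associated_prime I P ->
  exists2 s, s \in [:: a; b; c] & ~ P 'X_s.
Proof.
move=> [[_ P1 _] [h Ph]]; apply: NNPP => NP; apply: P1.
have PX s : s \in [:: a; b; c] -> P 'X_s.
  by move=> sabc; apply: NNPP => NPs; apply: NP; exists s.
apply/Ph; rewrite mul1r; apply/IG/monomial_genP => m mh.
have Gm s : s \in [:: a; b; c] -> mono_in G (U_(s) + m).
  move=> /PX/Ph/IG/monomial_genP; apply.
  by rewrite mulrC mcoeff_msupp mcoeffMX -mcoeff_msupp.
by apply: tri_colon; apply: Gm; rewrite !inE eqxx ?orbT.
Qed.

(** The factor s^k provides one s for each of the k generators; j of them use y and the other k - j
    use z, with j as large as the exponent of y allows. *)
Lemma gpow_tri_var s y z m :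
  (U_(s) + (U_(y) + p))%MM \in G -> (U_(s) + (U_(z) + p))%MM \in G ->
  y != s -> z != s -> y != z ->
  (p *+ k <= m)%MM -> (k + p y * k + p z * k <= m y + m z)%N ->
  mono_in (gpow G k) (U_(s) *+ k + m).
Proof.
move=> yG zG ys zs yz /mnm_lepP pm le_yz.
pose j := minn (m y - p y * k) k.
have jk : (j <= k)%N by apply: geq_minr.
apply/mono_inP; exists ((U_(s) + (U_(y) + p)) *+ j + (U_(s) + (U_(z) + p)) *+ (k - j))%MM.
  by rewrite -[X in gpow G X](subnKC jk); apply: gpowD => //; apply: gpow_muln.
apply/mnm_lepP => t; move: (pm t) (pm y) (pm z).
rewrite !(mnmDE, mulmnE, mnm1E) => + py pz.
have : (p t * k = p t * j + p t * (k - j))%N by rewrite -mulnDr subnKC.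
have jE : (k - j + j = k)%N by apply: subnK.
rewrite !mulnDl; case: (eqVneq s t) ys zs => [<-|_ _ _].
  by move=> /negPf-> /negPf->; lia.
case: (eqVneq y t) yz => [<-|_ _].
  by rewrite eq_sym => /negPf->; rewrite /j; lia.
by case: (eqVneq z t) => [<-|_]; rewrite /j; lia.
Qed.

Lemma tri_symbolic_pow f : monomial_gen tri_gens f -> symbolic_pow I k f.
Proof.
move=> Tf; apply/symbolic_powP => P assP.
have [s sabc Ps] := associated_prime_tri assP.
exists ('X_s ^+ k)%R; first by apply: prime_ideal_exp Ps; case: assP.
apply/(ideal_pow_monomial k IG)/monomial_genP => m.
rewrite mpolyXn => /msuppM_le /allpairsP[[m1 m2] /= [+ m2f ->]].
rewrite msuppX inE => /eqP->.
have Ga : (U_(b) + (U_(c) + p))%MM \in G by rewrite GE mem_head.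
have Gb : (U_(a) + (U_(c) + p))%MM \in G by rewrite GE !inE eqxx orbT.
have Gc : (U_(a) + (U_(b) + p))%MM \in G by rewrite GE !inE eqxx !orbT.
have AC x y : (U_(x) + (U_(y) + p) = U_(y) + (U_(x) + p))%MM.
  by rewrite !addmA [(U_(x) + _)%MM]addmC.
have /monomial_genP/(_ _ m2f)/mono_inP[u uT um] := Tf.
move: uT => /tri_gensP[x [y [z [uE [j jk H]]]]].
have pm : (p *+ k <= m2)%MM.
  by apply: lepm_trans um; rewrite uE /tri !addmA lem_addl.
have [ua ub uc] := triE x y z; rewrite -uE in ua ub uc.
move: (mnm_lepP um a) (mnm_lepP um b) (mnm_lepP um c); rewrite ua ub uc => ma mb mc.
have [xy xz yz] : [/\ k <= x + y, k <= x + z & k <= y + z]%N.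
  by clear -H jk; case: H => -[-> -> ->]; split; lia.
move: sabc; rewrite !inE => /or3P[] /eqP->.
- apply: (@gpow_tri_var a b c); rewrite ?ne //; lia.
- by apply: (@gpow_tri_var b a c); rewrite ?ne // 1?AC //; lia.
- by apply: (@gpow_tri_var c a b); rewrite ?ne // 1?AC //; lia.
Qed.

Lemma symbolic_pow_tri_regularity :
  has_regularity (symbolic_pow I k) (k * (mdeg p).+2) /\
  has_linear_quotients (symbolic_pow I k).
Proof.
apply: (deglex_lq_regularity tri_gens_antichain tri_gens_lq).
- by move=> f; split; [apply: symbolic_pow_tri | apply: tri_symbolic_pow].
- move=> u /tri_gensP[x [y [z [-> [j jk H]]]]]; rewrite mdeg_tri !mulnS.
  by case: H => -[-> -> ->]; rewrite mulnC; lia.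
(* The degree 2k - j + k deg p is largest at j = 0. *)
- exists (tri 0 k k); last by rewrite mdeg_tri !mulnS mulnC; lia.
  apply/tri_gensP; do 3 eexists; split; first by reflexivity.
  by exists 0 => //; constructor 1; rewrite subn0.
Qed.

End Triangle.

Theorem proposition6p5 (K : fieldType) (n : nat) (I : {mpoly K[n]} -> Prop)
    (G : seq 'X_{1..n}) (k : nat) :
  polymatroidal I ->
  min_monomial_gens I G ->
  (#|occurring_vars G| <= 3)%N ->
  (1 <= k)%N ->
  (exists r : nat,
     has_regularity (symbolic_pow I k) r /\ has_regularity (ideal_pow I k) r) /\
  has_linear_quotients (symbolic_pow I k).
Proof.
move=> [G0 [[_ IG0 _] G00 [d degG0] exG0]] [_ IG _] le3 _.
(* The list from [polymatroidal] may differ from the given G. Each u in it is divisible by some v in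
   G, itself divisible by a w in the list; equal degrees force u = v = w. *)
have sG0G : {subset G0 <= G}.
  move=> u uG0.
  have /IG0/IG/monomial_genX/mono_inP[v vG vu] : @monomial_gen K n G0 'X_[u].
    by apply/monomial_genX/mono_inP; exists u => //; apply: lepm_refl.
  have /IG/IG0/monomial_genX/mono_inP[w wG0 wv] : @monomial_gen K n G 'X_[v].
    by apply/monomial_genX/mono_inP; exists v => //; apply: lepm_refl.
  have wu : w = u.
    by apply: lem_mdeg (lepm_trans wv vu) _; rewrite (degG0 _ wG0) (degG0 _ uG0).
  suff -> : u = v by [].
  by apply/eqP; rewrite eq_sym; apply/eqP/mnmP => i; apply/eqP;
    rewrite eqn_leq (mnm_lepP vu) -wu (mnm_lepP wv).
have le3' : (#|active G0| <= 3)%N.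
  apply: leq_trans le3; apply/subset_leq_card/subsetP => i.
  rewrite !inE => /hasP[u uG0 /hasP[v _ vui]].
  by apply/hasP; exists u; [apply: sG0G | rewrite -lt0n; apply: leq_ltn_trans vui].
have [regIk lqIk] := polymatroidal_pow_regularity exG0 G00 degG0 (ideal_pow_monomial k IG0).
have reg_full w : (forall i, i \in active G0 -> (U_(i) + w)%MM \in G0) ->
    (exists r : nat, has_regularity (symbolic_pow I k) r /\
       has_regularity (ideal_pow I k) r) /\ has_linear_quotients (symbolic_pow I k).
  move=> wG.
  have sE : same_ideal (symbolic_pow I k) (monomial_gen (gpow G0 k)).
    move=> f; rewrite -(ideal_pow_monomial k IG0 f).
    apply: (symbolic_pow_full IG0 _ _ G00 degG0 _ wG) => g h i gG hG.
    exact: inactive_const.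
  have [regs lqs] := polymatroidal_pow_regularity exG0 G00 degG0 sE.
  by split=> //; exists (k * d)%N.
have [A0|[w wG]|] := active_trichotomy exG0 degG0 le3'.
- by apply: (reg_full 0%MM) => i; rewrite A0 inE.
- exact: reg_full wG.
move=> [a [b [c [p [abc GE AE]]]]].
have [regs lqs] := symbolic_pow_tri_regularity k abc IG0 GE.
split=> //; exists (k * d)%N; split=> //.
suff -> : d = (mdeg p).+2 by [].
have cG0 : (U_(a) + (U_(b) + p))%MM \in G0 by rewrite GE !inE eqxx !orbT.
by rewrite -(degG0 _ cG0) !mdegD !mdeg1; lia.
Qed.
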